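(* Let the time-step size be $\tau=T/N$ with $N\in\mathbb{N}$, $N\ge 2$. Suppose that $(\boldsymbol{u}_{n+1},p_{n+1})\in [H^1_0(\Omega)]^d\times L^2_0(\Omega)$, $n=0,\dots,N-1$, satisfy, starting from the initial velocity $\boldsymbol{u}_0$, the monolithic implicit-explicit stress-divergence scheme $$\frac{1}{\tau}(\boldsymbol{u}_{n+1}-\boldsymbol{u}_{n},\boldsymbol{w})+(\nu_{n+1}\nabla\boldsymbol{u}_{n+1},\nabla\boldsymbol{w}) + ((\nabla\boldsymbol{u}_{n+1})\boldsymbol{u}_n,\boldsymbol{w})-(p_{n+1},\nabla\cdot\boldsymbol{w}) = -\left(\sqrt{\nu_{n}}\,\nabla^{\top}\boldsymbol{u}_{n},\sqrt{\nu_{n+1}}\,\nabla\boldsymbol{w}\right) + (\boldsymbol{f}_{n+1},\boldsymbol{w}),$$ $$(q,\nabla\cdot\boldsymbol{u}_{n+1}) = 0,$$ for all $(\boldsymbol{w},q)\in [H^1_0(\Omega)]^d\times L^2_0(\Omega)$ and all $n=0,\dots,N-1$. Then, for every constant $\varepsilon>0$, $$\|\boldsymbol{u}_{N}\|^2 + \tau\big\| \sqrt{\nu_{N}}\,\nabla\boldsymbol{u}_{N}\big\|^2 + \varepsilon\sum_{n=1}^{N-1}\frac{\tau^2}{T}\big\| \sqrt{\nu_{n}}\,\nabla\boldsymbol{u}_{n}\big\|^2 \leq \mathrm{e}^{\varepsilon}\Bigg[C_0 + \Big(\tau + \frac{T}{\varepsilon}\Big)\sum_{n=1}^{N}\tau\|\boldsymbol{f}_{n}\|^2\Bigg],$$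 where $$C_0 = \left(1+\varepsilon\frac{\tau}{T}\right)\|\boldsymbol{u}_{0}\|^2 + \tau\|\sqrt{\nu_0}\,\nabla\boldsymbol{u}_0 \|^2 .$$
   Context: Setting: $\Omega\subset\mathbb{R}^d$, $d=2$ or $3$, is a bounded domain with Lipschitz boundary, $T>0$, and $Q=\Omega\times(0,T]$. The problem discretised in time is the incompressible Navier--Stokes system $\partial_t\boldsymbol{u}+(\nabla\boldsymbol{u})\boldsymbol{u}-\nabla\cdot[2\nu\nabla^{\mathrm{s}}\boldsymbol{u}]+\nabla p=\boldsymbol{f}$, $\nabla\cdot\boldsymbol{u}=0$ in $Q$, $\boldsymbol{u}=\boldsymbol{0}$ on $\partial\Omega\times(0,T]$, $\boldsymbol{u}=\boldsymbol{u}_0$ at $t=0$, where $\nabla^{\mathrm{s}}$ is the symmetric gradient. The viscosity $\nu=\nu(\boldsymbol{x},t)$ is given, with $\nu\ge\nu_{\mathrm{min}}>0$ in $\bar Q$ for a constant $\nu_{\mathrm{min}}$, and is such that all integrals in the scheme and the estimate are well defined and finite. The data satisfy $\boldsymbol{f}\in[L^2(Q)]^d$ and $\boldsymbol{u}_0\in[H^1_0(\Omega)]^d$ with $\nabla\cdot\boldsymbol{u}_0=0$. Notation: $t_n=n\tau$, $\nu_n=\nu(\cdot,t_n)$, $\boldsymbol{f}_n=\boldsymbol{f}(\cdot,t_n)\in[L^2(\Omega)]^d$. $(\cdot,\cdot)$ and $\|\cdot\|$ are the $L^2(\Omega)$ inner product and norm for scalar-, vector- and tensor-valued functions (Euclidean/Frobenius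 products pointwise). $L^2_0(\Omega)$ is the space of $L^2(\Omega)$ functions with zero mean. $(\nabla\boldsymbol{u})_{ij}=\partial_j u_i$, $\nabla^{\top}\boldsymbol{u}=(\nabla\boldsymbol{u})^{\top}$, and $((\nabla\boldsymbol{w})\boldsymbol{v})_i=\sum_j v_j\partial_j w_i$. *)

(* Defs.v *)
From HB Require Import structures.
From mathcomp Require Import all_boot all_order all_algebra.
From mathcomp Require Import all_classical all_reals all_analysis.

Set Implicit Arguments.
Unset Strict Implicit.
Unset Printing Implicit Defensive.
Import Order.TTheory GRing.Theory Num.Theory.
Import numFieldNormedType.Exports.
Local Open Scope classical_set_scope.
Local Open Scope ring_scope.

Definition rV_display : measure_display.
Proof. exact: default_measure_display. Qed.

(* The sigma-algebra on 'rV[R]_d generated by the coordinates, i.e. the Borel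
   sigma-algebra of R^d. *)
Section measurable_rV.
Context (R : realType) (d : nat).

Let coors : 'I_d -> 'rV[R]_d -> R := fun i x => x ord0 i.

Let rV_set0 : g_sigma_preimage coors set0.
Proof. exact: sigma_algebra0. Qed.

Let rV_setC A : g_sigma_preimage coors A -> g_sigma_preimage coors (~` A).
Proof. exact: sigma_algebraC. Qed.

Let rV_bigcup (F : (set 'rV[R]_d)^nat) :
  (forall i, g_sigma_preimage coors (F i)) ->
  g_sigma_preimage coors (\bigcup_i (F i)).
Proof. exact: sigma_algebra_bigcup. Qed.

HB.instance Definition _ := @isMeasurable.Build rV_display
  'rV[R]_d (g_sigma_preimage coors) rV_set0 rV_setC rV_bigcup.

Lemma measurable_coord (i : 'I_d) :
  measurable_fun [set: 'rV[R]_d] (fun x : 'rV[R]_d => x ord0 i).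
Proof.
move=> _ Y mY; rewrite setTI; apply: sub_sigma_algebra => /=.
rewrite -bigcup_seq/=; exists i => /=; first by rewrite mem_index_enum.
by exists Y => //; rewrite setTI.
Qed.

Lemma measurable_fun_coordP d1 (T1 : measurableType d1) (f : T1 -> 'rV[R]_d) :
  measurable_fun [set: T1] f <->
  forall i, measurable_fun [set: T1] (fun x => f x ord0 i).
Proof.
split=> [mf i|mf].
  by apply: (measurableT_comp (measurable_coord i)).
have sub : g_sigma_preimage (fun i x => f x ord0 i) `<=` @measurable _ T1.
  apply: smallest_sub; first exact: sigma_algebra_measurable.
  rewrite -bigcup_seq; apply: bigcup_sub => i _ A [B mB <-].
  exact: mf.
move=> _ A mA; apply: sub.
have -> : g_sigma_preimage (fun i x => f x ord0 i) =
  preimage_set_system [set: T1] f (g_sigma_preimage coors).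
  exact: (g_sigma_preimage_comp coors f).
by exists A.
Qed.

End measurable_rV.

Section rV_cons.
Context (R : realType) (d : nat).

Definition rV_cons (z : measurableTypeR R * 'rV[R]_d) : 'rV[R]_d.+1 :=
  row_mx (const_mx (z.1 : R) : 'rV[R]_1) z.2.

Definition rV_uncons (x : 'rV[R]_d.+1) : measurableTypeR R * 'rV[R]_d :=
  (x ord0 ord0, rsubmx (x : 'rV[R]_(1 + d))).

Lemma rV_consK : cancel rV_cons rV_uncons.
Proof.
case=> a v; rewrite /rV_uncons /rV_cons row_mxKr; congr pair.
by rewrite mxE; case: splitP => // j _; rewrite mxE.
Qed.

Lemma measurable_rV_cons :
  measurable_fun [set: measurableTypeR R * 'rV[R]_d] rV_cons.
Proof.
apply/measurable_fun_coordP => i.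
rewrite (_ : (fun _ => _) = fun z : measurableTypeR R * 'rV[R]_d =>
    if fintype.split (i : 'I_(1 + d)) is inr j then z.2 ord0 j else z.1).
  case: (fintype.split _) => [_|j]; first exact: measurable_fst.
  exact: (measurableT_comp (measurable_coord j) measurable_snd).
apply/funext => z; rewrite /rV_cons mxE.
by case: (fintype.split _) => j //; rewrite mxE.
Qed.

Lemma measurable_rV_uncons : measurable_fun [set: 'rV[R]_d.+1] rV_uncons.
Proof.
apply: measurable_fun_pair; first exact: measurable_coord.
apply/measurable_fun_coordP => i.
rewrite (_ : (fun _ => _) =
  (fun x : 'rV[R]_d.+1 => x ord0 (rshift 1 i : 'I_d.+1))).
  exact: measurable_coord.
by apply/funext => x; rewrite mxE.
Qed.

End rV_cons.

Section lebesgue_rV_cons.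
Local Open Scope ereal_scope.
Context (R : realType) (d : nat)
  (nu : {sigma_finite_measure set 'rV[R]_d -> \bar R}).

Definition lebesgue_rV_cons : set 'rV[R]_d.+1 -> \bar R :=
  pushforward ((@lebesgue_measure R) \x nu) (@rV_cons R d).

Let mf := @measurable_rV_cons R d.

Let lebesgue_rV_cons0 : lebesgue_rV_cons set0 = 0.
Proof. exact: measure0. Qed.

Let lebesgue_rV_cons_ge0 A : 0 <= lebesgue_rV_cons A.
Proof. exact: measure_ge0. Qed.

Let lebesgue_rV_cons_sigma_additive : semi_sigma_additive lebesgue_rV_cons.
Proof. exact: measure_semi_sigma_additive. Qed.

HB.instance Definition _ := isMeasure.Build _ _ _ lebesgue_rV_cons
  lebesgue_rV_cons0 lebesgue_rV_cons_ge0 lebesgue_rV_cons_sigma_additive.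

Let lebesgue_rV_cons_sigma_finite : sigma_finite setT lebesgue_rV_cons.
Proof.
have /sigma_finiteP[F [FT ndF Foo]] := sigma_finiteT (@lebesgue_measure R).
have /sigma_finiteP[G [GT ndG Goo]] := sigma_finiteT nu.
exists (fun n => (@rV_uncons R d) @^-1` (F n `*` G n)).
  apply/esym; rewrite -preimage_bigcup -subTset => x _ /=.
  have [n _ Fn] : (\bigcup_i F i) (rV_uncons x).1 by rewrite -FT.
  have [k _ Gk] : (\bigcup_i G i) (rV_uncons x).2 by rewrite -GT.
  exists (maxn n k) => //; split.
    by move: Fn; exact/subsetPset/ndF/leq_maxl.
  by move: Gk; exact/subsetPset/ndG/leq_maxr.
move=> n; have [mF Fn] := Foo n; have [mG Gn] := Goo n; split.
  rewrite -[X in measurable X]setTI.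
  by apply: measurable_rV_uncons => //; exact: measurableX.
rewrite /lebesgue_rV_cons /pushforward -comp_preimage.
rewrite (_ : _ \o _ = id); last by apply/funext => z; exact: rV_consK.
by rewrite preimage_id product_measure1E// lte_mul_pinfty// ge0_fin_numE.
Qed.

HB.instance Definition _ := Measure_isSigmaFinite.Build _ _ _
  lebesgue_rV_cons lebesgue_rV_cons_sigma_finite.

End lebesgue_rV_cons.

(* The d-dimensional Lebesgue measure: the d-fold product of lebesgue_measure,
   transported to row vectors. *)
Fixpoint lebesgue_rV (R : realType) (d : nat) :
    {sigma_finite_measure set 'rV[R]_d -> \bar R} :=
  match d with
  | 0 => (\d_ (0 : 'rV[R]_0) : {sigma_finite_measure set 'rV[R]_0 -> \bar R})
  | d'.+1 => (lebesgue_rV_cons (lebesgue_rV R d') :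
      {sigma_finite_measure set 'rV[R]_d'.+1 -> \bar R})
  end.

Lemma lebesgue_rV_box (R : realType) (d : nat) (A : 'I_d -> set R) :
  (forall i, measurable (A i)) ->
  lebesgue_rV R d [set x | forall i, A i (x ord0 i)] =
  (\prod_(i < d) lebesgue_measure (A i))%E.
Proof.
elim: d A => [|d IH] A mA.
  by rewrite big_ord0 /= diracE mem_set// => -[].
rewrite big_ord_recl -IH//.
have E0 (z : measurableTypeR R * 'rV[R]_d) : rV_cons z ord0 ord0 = z.1.
  by have := congr1 fst (rV_consK z).
have EL (z : measurableTypeR R * 'rV[R]_d) i :
    rV_cons z ord0 (lift ord0 i) = z.2 ord0 i.
  rewrite /rV_cons (_ : lift ord0 i = rshift 1 i); last exact: val_inj.
  exact: (row_mxEr (const_mx (z.1 : R) : 'rV[R]_1) z.2).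
have mB : measurable
    [set x : 'rV[R]_d | forall i, A (lift ord0 i) (x ord0 i)].
  rewrite (_ : [set _ | _] = \bigcap_(i in setT)
     ((fun x : 'rV[R]_d => x ord0 i) @^-1` A (lift ord0 i))); last first.
    by apply/seteqP; split => [x xA i _|x xA i]; [exact: xA|exact: (xA i)].
  apply: fin_bigcap_measurable => // i _.
  by rewrite -[X in measurable X]setTI; exact: measurable_coord.
rewrite -(product_measure1E lebesgue_measure (lebesgue_rV R d) (mA ord0) mB).
congr (product_measure1 _ _ _).
apply/seteqP; split => z /=.
  by move=> zA; split => [|i]; [rewrite -(E0 z)|rewrite -(EL z)]; exact: zA.
by move=> [z1 z2] i; case: (unliftP ord0 i) => [j|] ->; rewrite ?EL ?E0.
Qed.

Section domain.
Context (R : realType) (d : nat).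

Definition dotv (x y : 'rV[R]_d) : R := \sum_i x ord0 i * y ord0 i.

(* Near each boundary point, Omega is the part strictly above the graph of a
   Lipschitz function g over the hyperplane orthogonal to a unit vector e:
   [x - dotv x e *: e] is the projection of x on that hyperplane and [dotv x e]
   its height. *)
Definition lipschitz_boundary (Omega : set 'rV[R]_d) : Prop :=
  forall x0, (closure Omega `\` Omega°) x0 ->
  exists (e : 'rV[R]_d) (g : 'rV[R]_d -> R),
    [/\ dotv e e = 1, lipschitz g &
        \forall x \near x0,
          Omega x <-> g (x - dotv x e *: e) < dotv x e].

Definition bounded_lipschitz_domain (Omega : set 'rV[R]_d) : Prop :=
  [/\ open Omega, connected Omega, Omega !=set0, bounded_set Omega &
      lipschitz_boundary Omega].

End domain.

Section function_spaces.
Context (R : realType) (d : nat) (Omega : set 'rV[R]_d).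

Local Notation mu := (lebesgue_rV R d).

Definition partial (i : 'I_d) (f : 'rV[R]_d -> R) : 'rV[R]_d -> R :=
  fun x => 'D_(delta_mx ord0 i) f x.

Definition smooth (f : 'rV[R]_d -> R) : Prop :=
  forall s : seq 'I_d, let g := foldr partial f s in
  continuous g /\ forall i x, derivable g x (delta_mx ord0 i).

Definition test_function (phi : 'rV[R]_d -> R) : Prop :=
  let supp := closure [set x | phi x != 0] in
  [/\ smooth phi, compact supp & supp `<=` Omega].

(* Elements of L^2 and of the Sobolev spaces are represented by functions on the
   whole space; only their values on Omega, up to null sets, matter. *)
Definition L2 (f : 'rV[R]_d -> R) : Prop :=
  measurable_fun Omega f /\ mu.-integrable Omega (fun x => (f x ^+ 2)%:E).

Definition ip (f g : 'rV[R]_d -> R) : R := \int[mu]_(x in Omega) (f x * g x).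

Definition L20 (q : 'rV[R]_d -> R) : Prop :=
  L2 q /\ \int[mu]_(x in Omega) q x = 0.

Definition is_weak_partial (i : 'I_d) (f g : 'rV[R]_d -> R) : Prop :=
  forall phi, test_function phi -> ip f (partial i phi) = - ip g phi.

(* A chosen representative of the weak partial derivative, when it exists in
   L^2 (it is then unique up to a null set). *)
Definition wpartial (i : 'I_d) (f : 'rV[R]_d -> R) : 'rV[R]_d -> R :=
  xget (fun=> 0) [set g | L2 g /\ is_weak_partial i f g].

Definition H1 (f : 'rV[R]_d -> R) : Prop :=
  L2 f /\ forall i, exists g, L2 g /\ is_weak_partial i f g.

(* The squared H^1 distance between f and a test function phi, whose weak
   derivatives are the classical ones. *)
Definition H1_dist2 (f phi : 'rV[R]_d -> R) : R :=
  \int[mu]_(x in Omega) ((f x - phi x) ^+ 2) +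
  \sum_i \int[mu]_(x in Omega) ((wpartial i f x - partial i phi x) ^+ 2).

Definition H10 (f : 'rV[R]_d -> R) : Prop :=
  H1 f /\
  forall e, 0 < e -> exists phi, test_function phi /\ H1_dist2 f phi < e.

Definition H10v (v : 'rV[R]_d -> 'cV[R]_d) : Prop :=
  forall i, H10 (fun x => v x i ord0).

Definition wgrad (v : 'rV[R]_d -> 'cV[R]_d) (x : 'rV[R]_d) : 'M[R]_d :=
  \matrix_(i, j) wpartial j (fun y => v y i ord0) x.

Definition wdiv (v : 'rV[R]_d -> 'cV[R]_d) (x : 'rV[R]_d) : R :=
  \tr (wgrad v x).

Definition frob (m n : nat) (A B : 'M[R]_(m, n)) : R :=
  \sum_i \sum_j A i j * B i j.

Definition ipM (m n : nat) (F G : 'rV[R]_d -> 'M[R]_(m, n)) : R :=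
  \int[mu]_(x in Omega) frob (F x) (G x).

Definition normM (m n : nat) (F : 'rV[R]_d -> 'M[R]_(m, n)) : R :=
  Num.sqrt (ipM F F).

Definition L2M (m n : nat) (F : 'rV[R]_d -> 'M[R]_(m, n)) : Prop :=
  forall i j, L2 (fun x => F x i j).

(* The space [L^2(Q)]^d for the space-time cylinder Q = Omega * ]0, T]. *)
Definition L2Q (T : R) (f : 'rV[R]_d -> R -> 'cV[R]_d) : Prop :=
  let Q : set ('rV[R]_d * measurableTypeR R) := Omega `*` `]0, T] in
  forall i,
    measurable_fun Q (fun z => f z.1 z.2 i ord0) /\
    (mu \x (@lebesgue_measure R))%E.-integrable Q
      (fun z => (f z.1 z.2 i ord0 ^+ 2)%:E).

End function_spaces.

(* Main.v *)
(* Testing the scheme with [u_(n+1)] kills the pressure term, and the convective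
   term as well because [u_n] is weakly divergence free.  The inner product of
   the increment with [u_(n+1)] is half of [|u_(n+1)|^2 - |u_n|^2] plus half of
   the squared norm of the increment; that last term absorbs the part
   [(f, u_(n+1) - u_n)] of the forcing, while [(f, u_n)] and the explicit
   viscous term are split by Young's inequality.  Hence, with
   [c = eps tau / T] and [V n] the squared viscous norm,
   [|u_(n+1)|^2 + tau V (n+1) <= |u_n|^2 + tau V n + c |u_n|^2 + forcing].
   For [n >= 1], writing the third term as [c (|u_n|^2 + tau V n) - c tau V n]
   produces the sum of viscous norms, and a discrete Gronwall argument with
   [(1 + c)^N <= exp eps] concludes.

   The vanishing of the convective term needs [v_j w] in [L^2] for [v_j], [w]
   in [H^1_0], i.e. the embedding of [H^1_0] in [L^4] for [d = 2, 3].  It is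
   obtained from Ladyzhenskaya's inequality for test functions: on a line,
   [phi^2 <= int 2 |phi phi'|]; multiplying two such bounds in orthogonal
   directions and integrating gives [d = 2], and integrating the planar
   inequality over parallel slices gives [d = 3]. *)
Require Import Defs.
From mathcomp Require Import all_boot all_order all_algebra.
From mathcomp Require Import all_classical all_reals all_analysis.
From mathcomp Require Import measurable_realfun.
From mathcomp Require Import ring lra.
Import Order.TTheory GRing.Theory Num.Theory.
Import numFieldNormedType.Exports.
Local Open Scope classical_set_scope.
Local Open Scope ring_scope.
Set Implicit Arguments.
Unset Strict Implicit.
Unset Printing Implicit Defensive.

(** * Borel sets of 'rV *)

Section borel_rV.
Context (R : realType) (d : nat).
Implicit Types (x y : 'rV[R]_d) (O : set 'rV[R]_d).

(** The half-open grid cubes of side [1/(n+1)]: countably many over all [n], with diameters tending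
    to zero. *)
Let cell (nz : nat * {ffun 'I_d -> int}) : set 'rV[R]_d :=
  [set x | forall i, Num.floor (x ord0 i * nz.1.+1%:R) = nz.2 i].

Let measurable_cell nz : measurable (cell nz).
Proof.
rewrite (_ : cell nz = \bigcap_(i in setT)
    ((fun x : 'rV[R]_d => x ord0 i) @^-1`
     [set t | t * nz.1.+1%:R \in `[(nz.2 i)%:~R, (nz.2 i + 1)%:~R[])).
  apply: fin_bigcap_measurable => // i _.
  rewrite -[X in measurable X]setTI; apply: measurable_coord => //.
  have mM : measurable_fun setT (fun t : R => t * nz.1.+1%:R).
    by apply: measurable_funM => //; exact: measurable_cst.
  have := mM measurableT _ (measurable_itv `[(nz.2 i)%:~R, (nz.2 i + 1)%:~R[).
  by rewrite setTI.
apply/seteqP; split=> x /= h i.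
  by move=> _ /=; rewrite -h in_itv/= floor_itv.
have := h i Logic.I; rewrite /= in_itv/= => /andP[h1 h2].
exact/floor_def/andP.
Qed.

Let cell_dist n z x y i : cell (n, z) x -> cell (n, z) y ->
  `|x ord0 i - y ord0 i| < n.+1%:R^-1.
Proof.
move=> /(_ i)/= hx /(_ i)/= hy.
have := floor_itv (x ord0 i * n.+1%:R).
have := floor_itv (y ord0 i * n.+1%:R).
rewrite hx hy intrD => /andP[y1 y2] /andP[x1 x2].
rewrite -(ltr_pM2r (ltr0Sn R n)) mulVf ?pnatr_eq0//.
by rewrite -[X in _ * X](gtr0_norm (ltr0Sn R n)) -normrM mulrBl ltr_norml; lra.
Qed.

(** The sigma-algebra is generated by the coordinates, so an open set is cut into countably many
    measurable pieces: each of its points lies in a grid cube fine enough to stay inside it. *)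
Lemma open_measurable_rV O : open O -> measurable O.
Proof.
move=> oO.
have -> : O = \bigcup_(nz in [set nz | cell nz `<=` O]) cell nz.
  apply/seteqP; split=> [x Ox|x [nz /= h]]; last exact: h.
  have /nbhs_ballP[r /= r0 rO] : nbhs x O by move: oO; rewrite openE; exact.
  have [n nr] : exists n, n.+1%:R^-1 < r :> R.
    have := near_infty_natSinv_lt (PosNum r0).
    by case=> n _ /(_ n)/= h; exists n; exact: h.
  pose z : {ffun 'I_d -> int} := [ffun i => Num.floor (x ord0 i * n.+1%:R)].
  have xz : cell (n, z) x by move=> i /=; rewrite ffunE.
  exists (n, z) => //= y yz; apply: rO; split=> // i j.
  by rewrite ord1; exact: lt_trans (cell_dist j xz yz) nr.
rewrite bigcup_mkcond; apply: countable_bigcupT_measurable => [|nz].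
  exact: countableP.
by case: ifP.
Qed.

Lemma continuous_measurable_rV (f : 'rV[R]_d -> R) :
  continuous f -> measurable_fun setT f.
Proof.
move=> cf; apply: (measurability _ (RGenOpens.measurableE R)).
move=> _ [_ [a [b ->] <-]]; rewrite setTI; apply: open_measurable_rV.
by apply: open_comp; [move=> x _; exact: cf|exact: interval_open].
Qed.

End borel_rV.

(** * Tonelli's theorem for the Lebesgue measure on row vectors *)

Lemma coord_le_norm (R : realType) (d : nat) (x : 'rV[R]_d) i :
  `|x ord0 i| <= `|x|.
Proof.
rewrite /Num.norm/= mx_normrE.
exact: (le_bigmax 0 (fun ij : 'I_1 * 'I_d => `|x ij.1 ij.2|) (ord0, i)).
Qed.

Lemma bounded_rV_measure_lty (R : realType) (d : nat) (A : set 'rV[R]_d) :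
  measurable A -> bounded_set A -> (lebesgue_rV R d A < +oo)%E.
Proof.
move=> mA [M [_ /(_ (`|M| + 1))]] AM.
(* [bounded_set] gives the bound for radii strictly above [M] only; [|M| + 1] is such a radius and
   is positive. *)
set c := `|M| + 1 in AM.
have {}AM : A `<=` [set x | forall i, `[- c, c]%classic (x ord0 i)].
  move=> x Ax i /=; rewrite in_itv/= -ler_norml.
  apply: le_trans (coord_le_norm _ _) _; apply: AM => //.
  by rewrite /c; have := ler_norm M; lra.
have mB : measurable [set x : 'rV[R]_d | forall i, `[- c, c]%classic (x ord0 i)].
  rewrite (_ : [set _ | _] = \bigcap_(i in setT)
     ((fun x : 'rV[R]_d => x ord0 i) @^-1` `[- c, c]%classic)); last first.
    by apply/seteqP; split => [x xA i _|x xA i]; [exact: xA|exact: (xA i)].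
  apply: fin_bigcap_measurable => // i _.
  by rewrite -[X in measurable X]setTI; exact: measurable_coord.
have c_gt0 : 0 < c by rewrite /c ltr_wpDl.
apply: (@le_lt_trans _ _ (\prod_(i < d) lebesgue_measure `[(- c)%R, c%R]%classic)%E).
  rewrite -(@lebesgue_rV_box R d (fun _ => `[- c, c]%classic))//.
  by apply: le_measure => //; rewrite inE.
by rewrite lebesgue_measure_itv/= lte_fin gtrN// prodEFin ltry.
Qed.

Section tonelli_rV.
Local Open Scope ereal_scope.
Context (R : realType) (d : nat).
Local Notation mu := (lebesgue_rV R d).
Implicit Type F : 'rV[R]_d.+1 -> \bar R.

Let cons_fun F := (fun z : measurableTypeR R * 'rV[R]_d => F (rV_cons z)).

Let integral_rV_succ F : measurable_fun setT F -> (forall x, 0 <= F x) ->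
  \int[lebesgue_rV R d.+1]_x F x = \int[lebesgue_measure \x mu]_z cons_fun F z.
Proof.
move=> mF F0.
by rewrite (ge0_integral_pushforward (@measurable_rV_cons R d)).
Qed.

Let measurable_cons_fun F :
  measurable_fun setT F -> measurable_fun setT (cons_fun F).
Proof. by move=> mF; exact: measurableT_comp mF (@measurable_rV_cons R d). Qed.

Lemma integral_rV_cons1 F : measurable_fun setT F -> (forall x, 0 <= F x) ->
  \int[lebesgue_rV R d.+1]_x F x =
  \int[lebesgue_measure]_a \int[mu]_y F (rV_cons (a, y)).
Proof.
move=> mF F0; rewrite integral_rV_succ//.
exact: fubini_tonelli1 (measurable_cons_fun mF) (fun=> F0 _).
Qed.

Lemma integral_rV_cons2 F : measurable_fun setT F -> (forall x, 0 <= F x) ->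
  \int[lebesgue_rV R d.+1]_x F x =
  \int[mu]_y \int[lebesgue_measure]_a F (rV_cons (a, y)).
Proof.
move=> mF F0; rewrite integral_rV_succ//.
exact: fubini_tonelli2 (measurable_cons_fun mF) (fun=> F0 _).
Qed.

Lemma measurable_integral_cons1 F :
  measurable_fun setT F -> (forall x, 0 <= F x) ->
  measurable_fun setT (fun a : measurableTypeR R => \int[mu]_y F (rV_cons (a, y))).
Proof.
move=> mF F0.
apply: (measurable_fun_fubini_tonelli_F (cons_fun F)) => [|z]; last exact: F0.
exact: measurable_cons_fun.
Qed.

Lemma measurable_integral_cons2 F :
  measurable_fun setT F -> (forall x, 0 <= F x) ->
  measurable_fun setT
    (fun y : 'rV[R]_d => \int[lebesgue_measure]_a F (rV_cons (a, y))).
Proof.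
move=> mF F0.
apply: (measurable_fun_fubini_tonelli_G (cons_fun F)) => [|z]; last exact: F0.
exact: measurable_cons_fun.
Qed.

Lemma measurable_cons1 F a :
  measurable_fun setT F -> measurable_fun setT (fun y => F (rV_cons (a, y))).
Proof.
by move=> /measurable_cons_fun mF; exact: (measurableT_comp mF (pair1_measurable _)).
Qed.

Lemma rV_cons_line0 (a t : R) (y : 'rV[R]_d) :
  (rV_cons (a, y) + t *: delta_mx ord0 ord0 = rV_cons ((a + t)%R, y))%R.
Proof.
apply/rowP => i; rewrite /rV_cons !mxE; case: splitP => [k|k] ik.
  by rewrite !mxE/= (_ : i == ord0) ?mulr1//; apply/eqP/val_inj; rewrite /= ik ord1.
rewrite (_ : i == ord0 = false) ?andbF ?mulr0 ?addr0//.
by apply/eqP => i0; rewrite i0 /= add1n in ik.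
Qed.

Lemma rV_cons_lineS (a t : R) (y : 'rV[R]_d) (j : 'I_d) :
  (rV_cons (a, y) + t *: delta_mx ord0 (lift ord0 j) =
   rV_cons (a, y + t *: delta_mx ord0 j))%R.
Proof.
apply/rowP => i; rewrite /rV_cons !mxE; case: splitP => [k|k] ik.
  rewrite (_ : i == lift ord0 j = false) ?andbF ?mulr0 ?addr0 ?mxE//.
  by apply/eqP => ij; move: ik; rewrite ij ord1.
rewrite !mxE eqxx/=; congr (_ + _ * (nat_of_bool _)%:R)%R.
apply/eqP/eqP => [e|<-]; apply/val_inj; first by move: ik; rewrite e => -[].
by rewrite /= ik.
Qed.

End tonelli_rV.

(** Induction on the dimension: Tonelli puts the integral along [j] innermost if [j] is the first
    coordinate, and otherwise reduces to slices with fixed first coordinate. Non-negative integrands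
    make the exchange free of integrability conditions. *)
Lemma eq_integral_lines (R : realType) (d : nat) (j : 'I_d)
    (F G : 'rV[R]_d -> \bar R) :
  measurable_fun setT F -> (forall x, (0 <= F x)%E) ->
  measurable_fun setT G -> (forall x, (0 <= G x)%E) ->
  (forall x, \int[lebesgue_measure]_(t in setT) F (x + t *: delta_mx ord0 j)%R =
             \int[lebesgue_measure]_(t in setT) G (x + t *: delta_mx ord0 j)%R)%E ->
  (\int[lebesgue_rV R d]_x F x = \int[lebesgue_rV R d]_x G x)%E.
Proof.
elim: d j F G => [[]//|d IH] j F G mF F0 mG G0.
case: (unliftP ord0 j) => [k|] -> FG.
  rewrite !integral_rV_cons1//; apply: eq_integral => a _.
  apply: (IH k) => //; [exact: measurable_cons1|exact: measurable_cons1|].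
  move=> y; have := FG (rV_cons (a, y)).
  by under eq_integral do rewrite rV_cons_lineS;
    under [in X in _ = X -> _]eq_integral do rewrite rV_cons_lineS.
rewrite !integral_rV_cons2//; apply: eq_integral => y _.
have := FG (rV_cons (0, y)).
by under eq_integral do rewrite rV_cons_line0 add0r;
  under [in X in _ = X -> _]eq_integral do rewrite rV_cons_line0 add0r.
Qed.

(** * Functions of one variable along coordinate lines *)

Lemma integral_outside0 d (T : measurableType d) (R : realType)
    (mu : {measure set T -> \bar R}) (D : set T) (f : T -> \bar R) :
  (forall t, ~ D t -> f t = 0%E) -> (\int[mu]_t f t = \int[mu]_(t in D) f t)%E.
Proof.
move=> f0; rewrite [RHS]integral_mkcond; congr (integral _ _ _).
apply/funext => t; rewrite /patch; case: ifPn => //.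
by rewrite notin_setE => /f0.
Qed.

Section real_line.
Context (R : realType).
Local Notation leb := (@lebesgue_measure R).
Implicit Types F f : R -> R.

Lemma FTC2_continuous F f (a b : R) : a < b -> continuous f ->
  (forall x, is_derive x (1 : R) F (f x)) ->
  (\int[leb]_(t in `[a, b]) (f t)%:E = (F b - F a)%:E)%E.
Proof.
move=> ab cf dF.
have cF : continuous F.
  move=> x; apply: differentiable_continuous; apply/derivable1_diffP.
  by have [] := dF x.
rewrite EFinB; apply: continuous_FTC2 => //.
- exact: continuous_subspaceT.
- split=> [x _||]; first by have [] := dF x.
  + exact/cvg_at_right_filter/cF.
  + exact/cvg_at_left_filter/cF.
- by move=> x _; rewrite derive1E; have [_ ->] := dF x.
Qed.

(** [F^2] at [x] is the integral of its derivative [2 F f] from a point to the left of [x] and of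
    the support of [F]. *)
Lemma sqr_le_integral F f (M : R) : continuous f ->
  (forall x, is_derive x (1 : R) F (f x)) -> (forall t, M < `|t| -> F t = 0) ->
  forall x, ((F x ^+ 2)%:E <= \int[leb]_t (2 * `|F t * f t|)%:E)%E.
Proof.
move=> cf dF F0 x.
have cF : continuous F.
  move=> y; apply: differentiable_continuous; apply/derivable1_diffP.
  by have [] := dF y.
pose a := - (`|M| + `|x| + 1).
have ax : a < x.
  by rewrite /a; have := ler_norm (- x); rewrite normrN; have := normr_ge0 M; lra.
have Fa : F a = 0.
  apply: F0; rewrite /a normrN ger0_norm; last by rewrite addr_ge0// addr_ge0.
  by have := ler_norm M; have := normr_ge0 x; lra.
have cg : continuous (fun t => 2 * (F t * f t)).
  by move=> t; apply: cvgM; [exact: cvg_cst|apply: cvgM; [exact: cF|exact: cf]].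
have dG t : is_derive t (1 : R) (F * F) (2 * (F t * f t)).
  apply: is_derive_eq (is_deriveM (dF t) (dF t)) _.
  by rewrite /GRing.scale/=; ring.
have := FTC2_continuous ax cg dG.
rewrite /= !fctE Fa mul0r subr0 -expr2 => <-.
have mg : measurable_fun setT (fun t => (2 * (F t * f t))%:E).
  by apply/measurable_EFinP; exact: continuous_measurable_fun.
have nrmE t : `|(2 * (F t * f t))%:E|%E = (2 * `|F t * f t|)%:E.
  by rewrite abse_EFin normrM ger0_norm.
apply: (@le_trans _ _ (\int[leb]_(t in `[a, x]) (2 * `|F t * f t|)%:E)%E).
  apply: le_trans (lee_abs _) _.
  apply: le_trans (le_abse_integral _ _ _) _ => //.
    exact: measurable_funS mg.
  by under eq_integral do rewrite nrmE.
apply: ge0_subset_integral => //.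
  under eq_fun do rewrite -nrmE.
  exact: measurableT_comp.
Qed.

(** The derivative of a compactly supported function has integral zero. This is written with
    positive and negative parts so that [eq_integral_lines], which takes non-negative integrands,
    can use it on every line. *)
Lemma integral_derive_pos_neg F f (M : R) : continuous f ->
  (forall x, is_derive x (1 : R) F (f x)) -> (forall t, M < `|t| -> F t = 0) ->
  (forall t, M < `|t| -> f t = 0) ->
  (\int[leb]_t (f^\+ t)%:E = \int[leb]_t (f^\- t)%:E)%E.
Proof.
move=> cf dF F0 f0.
pose b : R := `|M| + 1.
have Mb : M < b by rewrite /b; have := ler_norm M; lra.
have b0 : 0 < b by rewrite /b ltr_wpDl.
have ab : - b < b by lra.
have Fb : F b = 0 by apply: F0; rewrite gtr0_norm.
have Fa : F (- b) = 0 by apply: F0; rewrite normrN gtr0_norm.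
have out (t : R) : ~ `[- b, b]%classic t -> f t = 0.
  move=> /= /negP tb; apply: f0; apply: lt_trans Mb _.
  by rewrite ltNge ler_norml; move: tb; rewrite in_itv.
rewrite (@integral_outside0 _ _ _ leb `[- b, b]%classic); last first.
  by move=> t /out ft; rewrite /funrpos ft maxxx.
rewrite (@integral_outside0 _ _ _ leb `[- b, b]%classic); last first.
  by move=> t /out ft; rewrite /funrneg ft oppr0 maxxx.
have intf : leb.-integrable `[- b, b] (EFin \o f).
  apply: continuous_compact_integrable; first exact: segment_compact.
  exact: continuous_subspaceT.
have ip : leb.-integrable `[- b, b] (EFin \o f^\+) by exact: integrable_funrpos.
have iN : leb.-integrable `[- b, b] (EFin \o f^\-) by exact: integrable_funrneg.
have := FTC2_continuous ab cf dF.
rewrite Fb Fa subrr => intf0.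
have : (\int[leb]_(t in `[(- b)%R, b]) ((f^\+ t)%:E - (f^\- t)%:E) = 0)%E.
  rewrite -[RHS]intf0; apply: eq_integral => t _.
  by rewrite -EFinB -[in RHS](funrposBneg f).
rewrite integralB_EFin// => /eqP; rewrite sube_eq ?add0e//; first by move=> /eqP.
  exact: integrable_fin_num ip.
Qed.

End real_line.

(** * Restriction of functions to coordinate lines *)

Section lines.
Context (R : realType) (d : nat).
Local Notation leb := (@lebesgue_measure R).
Implicit Types (f : 'rV[R]_d -> R) (x v : 'rV[R]_d).

(** The class in which Ladyzhenskaya's inequality is proved: [C^1] functions with bounded support,
    with no reference to a domain, so that slices stay in the class. *)
Definition C1c f := [/\ continuous f,
  forall i x, derivable f x (delta_mx ord0 i),
  forall i, continuous (partial i f) &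
  exists M, forall x, M < `|x| -> f x = 0].

Lemma is_derive_line f x v t : derivable f (x + t *: v) v ->
  is_derive t (1 : R) (fun s => f (x + s *: v)) ('D_v f (x + t *: v)).
Proof.
move=> df.
have E : (fun h : R => h^-1 *: (((fun s => f (x + s *: v)) \o shift t) (h *: 1) -
      f (x + t *: v))) =
    (fun h : R => h^-1 *: ((f \o shift (x + t *: v)) (h *: v) - f (x + t *: v))).
  apply/funext => h /=; congr (_ *: (f _ - _)).
  have -> : h *: 1 = h :> R by rewrite /GRing.scale/= mulr1.
  by rewrite scalerDl addrCA.
split; first by rewrite /derivable E.
by rewrite /derive E.
Qed.

Lemma continuous_line f x v :
  continuous f -> continuous (fun t : R => f (x + t *: v)).
Proof.
move=> cf t; apply: (@continuous_comp _ _ _ (fun s : R => x + s *: v) f); last exact: cf.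
apply: cvgD; first exact: cvg_cst.
by apply: cvgZr_tmp; exact: cvg_id.
Qed.

Lemma partial_eq0 f (M : R) i x :
  (forall x, M < `|x| -> f x = 0) -> M < `|x| -> partial i f x = 0.
Proof.
move=> f0 Mx; rewrite /partial (@near_eq_derive _ _ _ f (cst 0)) ?derive_cst//.
near=> y; apply: f0; near: y.
apply: (@cvgr_gt _ _ _ _ _ `|x|) => //.
by apply: cvg_norm; exact: cvg_id.
Unshelve. all: by end_near. Qed.

(** The [i]-th coordinate of the point is [x_i + t]. Hence a function with bounded support keeps
    this property on every line. *)
Lemma norm_line_gt i x (M t : R) :
  M + `|x| < `|t| -> M < `|x + t *: delta_mx ord0 i|.
Proof.
move=> Mt; apply: lt_le_trans (coord_le_norm _ i).
rewrite !mxE !eqxx mulr1.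
have := coord_le_norm x i; have := ler_normB (x ord0 i + t) (x ord0 i).
by rewrite addrAC subrr add0r; lra.
Qed.

Lemma C1c_sqr_le f i x s : C1c f ->
  ((f (x + s *: delta_mx ord0 i) ^+ 2)%:E <=
   \int[leb]_t (2 * `|f (x + t *: delta_mx ord0 i) *
     partial i f (x + t *: delta_mx ord0 i)|)%:E)%E.
Proof.
case=> cf df cdf [M f0].
apply: (@sqr_le_integral R (fun t => f (x + t *: delta_mx ord0 i))
  (fun t => partial i f (x + t *: delta_mx ord0 i)) (M + `|x|)).
- exact: continuous_line.
- by move=> t; exact: is_derive_line.
- by move=> t Mt; apply: f0; exact: norm_line_gt.
Qed.

(** Every line in direction [i] contributes zero by the fundamental theorem of calculus, and Tonelli
    carries the equality to the whole space. *)
Lemma C1c_integral_pos_neg f i : C1c f ->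
  (\int[lebesgue_rV R d]_x ((partial i f)^\+ x)%:E =
   \int[lebesgue_rV R d]_x ((partial i f)^\- x)%:E)%E.
Proof.
case=> cf df cdf [M f0].
have mdf := continuous_measurable_rV (cdf i).
apply: (@eq_integral_lines _ _ i).
- by apply/measurable_EFinP; exact: measurable_funrpos.
- by move=> x; rewrite lee_fin funrpos_ge0.
- by apply/measurable_EFinP; exact: measurable_funrneg.
- by move=> x; rewrite lee_fin funrneg_ge0.
move=> x; apply: (@integral_derive_pos_neg R (fun t => f (x + t *: delta_mx ord0 i))
  (fun t => partial i f (x + t *: delta_mx ord0 i)) (M + `|x|)).
- exact: continuous_line.
- by move=> t; exact: is_derive_line.
- by move=> t Mt; apply: f0; exact: norm_line_gt.
- by move=> t Mt; apply: partial_eq0 f0 _; exact: norm_line_gt.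
Qed.

End lines.

(** * Ladyzhenskaya's inequality *)

Section cauchy_schwarz.
Local Open Scope ereal_scope.
Context d (T : measurableType d) (R : realType).
Variable mu : {measure set T -> \bar R}.

Let poweR2 (x : \bar R) : 0 <= x -> x `^ 2 = x * x.
Proof.
case: x => [r||]//; last by move=> _; rewrite poweRyr// mulyy.
by rewrite lee_fin => r0; rewrite poweR_EFin powR_mulrn// expr2 EFinM.
Qed.

(** Hoelder's inequality with exponents 2 and 2, squared; infinite integrals are included. *)
Lemma cauchy_schwarz_abs (f g : T -> R) :
  measurable_fun setT f -> measurable_fun setT g ->
  (\int[mu]_x `|f x * g x|%:E) * (\int[mu]_x `|f x * g x|%:E) <=
  (\int[mu]_x (f x ^+ 2)%:E) * (\int[mu]_x (g x ^+ 2)%:E).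
Proof.
move=> mf mg.
have sqE (h : T -> R) : 'N[mu]_2%:E[EFin \o h] * 'N[mu]_2%:E[EFin \o h] =
    \int[mu]_x (h x ^+ 2)%:E.
  rewrite -poweR2 ?Lnorm_ge0// poweR_Lnorm//; apply: eq_integral => x _ /=.
  by rewrite powR_mulrn// real_normK// num_real.
have half : (2^-1 + 2^-1 = 1 :> R)%R by lra.
have := hoelder mu mf mg (ltr0Sn R 1) (ltr0Sn R 1) half.
rewrite Lnorm1 => H.
have I0 : 0 <= \int[mu]_x `|f x * g x|%:E by exact: integral_ge0.
apply: le_trans (lee_pmul I0 I0 H H) _.
by rewrite muleACA !sqE.
Qed.

End cauchy_schwarz.

(** * Slices at a fixed first coordinate *)

Section slices.
Context (R : realType) (d : nat).

Lemma norm_le_coord (x : 'rV[R]_d) (c : R) :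
  0 <= c -> (forall i, `|x ord0 i| <= c) -> `|x| <= c.
Proof.
move=> c0 xc; rewrite /Num.norm/= mx_normrE; apply: bigmax_le => // -[i j] _.
by rewrite ord1; exact: xc.
Qed.

Lemma rV_consE0 (a : R) (y : 'rV[R]_d) : rV_cons (a, y) ord0 ord0 = a.
Proof. by have := congr1 fst (rV_consK (a, y)). Qed.

Lemma rV_consES (a : R) (y : 'rV[R]_d) i :
  rV_cons (a, y) ord0 (lift ord0 i) = y ord0 i.
Proof.
rewrite /rV_cons (_ : lift ord0 i = rshift 1 i); last exact: val_inj.
exact: (row_mxEr (const_mx a : 'rV[R]_1) y).
Qed.

Lemma norm_rV_cons_ge (a : R) (y : 'rV[R]_d) : `|y| <= `|rV_cons (a, y)|.
Proof.
apply: norm_le_coord => // i; rewrite -(rV_consES a).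
exact: coord_le_norm.
Qed.

Lemma continuous_rV_cons (a : R) :
  continuous (fun y : 'rV[R]_d => rV_cons (a, y)).
Proof.
move=> y U /nbhs_ballP[e e0 eU]; apply/nbhs_ballP; exists e => // z [_ yz].
apply: eU; split=> // i j; rewrite ord1.
case: (unliftP ord0 j) => [k|] ->; first by rewrite !rV_consES.
by rewrite !rV_consE0; exact: ballxx.
Qed.

Variable f : 'rV[R]_d.+1 -> R.

(** Equality of the difference quotients themselves gives both the derivability of slices and the
    value of their partial derivatives. *)
Let slice_quotient (a : R) (y : 'rV[R]_d) k :
  (fun h : R => h^-1 *: (((fun z => f (rV_cons (a, z))) \o shift y)
     (h *: delta_mx ord0 k) - f (rV_cons (a, y)))) =
  (fun h : R => h^-1 *: ((f \o shift (rV_cons (a, y)))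
     (h *: delta_mx ord0 (lift ord0 k)) - f (rV_cons (a, y)))).
Proof.
apply/funext => h /=; congr (_ *: (f _ - _)).
by rewrite addrC [RHS]addrC rV_cons_lineS.
Qed.

Lemma partial_slice (a : R) (y : 'rV[R]_d) k :
  partial k (fun z => f (rV_cons (a, z))) y =
  partial (lift ord0 k) f (rV_cons (a, y)).
Proof. by rewrite /partial /derive slice_quotient. Qed.

Lemma C1c_slice (a : R) : C1c f -> C1c (fun y : 'rV[R]_d => f (rV_cons (a, y))).
Proof.
case=> cf df cdf [M f0]; split.
- by move=> y; apply: continuous_comp; [exact: continuous_rV_cons|exact: cf].
- by move=> k y; rewrite /derivable slice_quotient; exact: df.
- move=> k; rewrite (_ : partial k _ =
    (fun y => partial (lift ord0 k) f (rV_cons (a, y)))); last first.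
    by apply/funext => y; rewrite partial_slice.
  by move=> y; apply: continuous_comp; [exact: continuous_rV_cons|exact: cdf].
- exists M => y My; apply: f0; exact: lt_le_trans My (norm_rV_cons_ge _ _).
Qed.

End slices.

Section ladyzhenskaya.
Local Open Scope ereal_scope.
Context (R : realType).
Local Notation leb := (@lebesgue_measure R).

(** The absolute value of the [i]-th partial derivative of [f^2], whose integral along a line bounds
    [f^2] on it. *)
Definition absfdf d (f : 'rV[R]_d -> R) i (x : 'rV[R]_d) : \bar R :=
  (2 * `|f x * partial i f x|)%:E.

Lemma measurable_absfdf d (f : 'rV[R]_d -> R) i :
  C1c f -> measurable_fun setT (absfdf f i).
Proof.
case=> cf _ cdf _; apply/measurable_EFinP; apply: measurable_funM => //.
apply: measurableT_comp => //; apply: measurable_funM;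
  exact: continuous_measurable_rV.
Qed.

Lemma absfdf_ge0 d (f : 'rV[R]_d -> R) i x : 0 <= absfdf f i x.
Proof. by rewrite lee_fin mulr_ge0. Qed.

Lemma integral_rV0 (F : 'rV[R]_0 -> \bar R) x :
  \int[lebesgue_rV R 0]_y F y = F x.
Proof.
have E y : F y = F x by rewrite (thinmx0 y) (thinmx0 x).
under eq_integral do rewrite E.
rewrite (_ : (fun=> F x) = cst (F x))// integral_cst//= diracE mem_set// mule1.
by [].
Qed.

Lemma integral_rV1 (F : 'rV[R]_1 -> \bar R) (z : 'rV[R]_0) :
  measurable_fun setT F -> (forall x, 0 <= F x) ->
  \int[lebesgue_rV R 1]_y F y = \int[leb]_t F (rV_cons (t, z)).
Proof.
by move=> mF F0; rewrite integral_rV_cons1//; apply: eq_integral => t _;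
  rewrite (integral_rV0 _ z).
Qed.

(** The first factor of the bound depends on [y] only and the second on [a] only, so the iterated
    integral of their product factorises. *)
Lemma integral_prod_le d (F A B : 'rV[R]_d.+1 -> \bar R) :
  measurable_fun setT F -> (forall x, 0 <= F x) ->
  measurable_fun setT A -> (forall x, 0 <= A x) ->
  measurable_fun setT B -> (forall x, 0 <= B x) ->
  (forall a y, F (rV_cons (a, y)) <=
    \int[leb]_b A (rV_cons (b, y)) * \int[lebesgue_rV R d]_z B (rV_cons (a, z))) ->
  \int[lebesgue_rV R d.+1]_x F x <=
  (\int[lebesgue_rV R d.+1]_x A x) * (\int[lebesgue_rV R d.+1]_x B x).
Proof.
move=> mF F0 mA A0 mB B0 FAB.
pose P (y : 'rV[R]_d) := \int[leb]_a A (rV_cons (a, y)).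
pose Q (a : measurableTypeR R) := \int[lebesgue_rV R d]_y B (rV_cons (a, y)).
have P0 y : 0 <= P y by exact: integral_ge0.
have Q0 a : 0 <= Q a by exact: integral_ge0.
have mP : measurable_fun setT P by exact: measurable_integral_cons2.
have mQ : measurable_fun setT Q by exact: measurable_integral_cons1.
rewrite (integral_rV_cons1 mF F0) (integral_rV_cons2 mA A0).
rewrite (integral_rV_cons1 mB B0) -/P -/Q.
have iP0 : 0 <= \int[lebesgue_rV R d]_y P y by exact: integral_ge0.
rewrite -(ge0_integralZl _ _ mQ)//.
apply: ge0_le_integral => //.
- by move=> a _; exact: integral_ge0.
- exact: measurable_integral_cons1.
- by apply: measurable_funeM.
move=> a _; rewrite muleC -(ge0_integralZl _ _ mP)//.
apply: ge0_le_integral => //.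
- exact: measurable_cons1.
- by apply: measurable_funeM.
by move=> y _; rewrite muleC; exact: FAB.
Qed.

(** The squared [H^1] norm over the whole space, as an extended real. *)
Definition h1e d (f : 'rV[R]_d -> R) : \bar R :=
  \int[lebesgue_rV R d]_x (f x ^+ 2)%:E +
  \sum_(i < d) \int[lebesgue_rV R d]_x (partial i f x ^+ 2)%:E.

Let int_sqr_ge0 d (g : 'rV[R]_d -> R) :
  0 <= \int[lebesgue_rV R d]_x (g x ^+ 2)%:E.
Proof. by apply: integral_ge0 => x _; rewrite lee_fin sqr_ge0. Qed.

Lemma h1e_ge0 d (f : 'rV[R]_d -> R) : 0 <= h1e f.
Proof. by rewrite adde_ge0// sume_ge0. Qed.

Let measurable_sqr d (f : 'rV[R]_d -> R) : continuous f ->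
  measurable_fun setT (fun x => (f x ^+ 2)%:E).
Proof.
move=> cf; apply/measurable_EFinP; apply: measurable_funX.
exact: continuous_measurable_rV.
Qed.

Lemma integral_absfdf_le d (f : 'rV[R]_d -> R) i : C1c f ->
  \int[lebesgue_rV R d]_x absfdf f i x <= h1e f.
Proof.
move=> Cf; have [cf _ cdf _] := Cf.
rewrite /h1e (bigD1 i)//= addeA.
apply: (@le_trans _ _ (\int[lebesgue_rV R d]_x (f x ^+ 2)%:E +
   \int[lebesgue_rV R d]_x (partial i f x ^+ 2)%:E)); last first.
  by rewrite leeDl// sume_ge0.
have sq0 (g : 'rV[R]_d -> R) x : 0 <= (g x ^+ 2)%:E by rewrite lee_fin sqr_ge0.
rewrite -ge0_integralD//; last 2 first.
- exact: measurable_sqr.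
- exact: measurable_sqr.
apply: ge0_le_integral => //.
- by move=> x _; exact: absfdf_ge0.
- exact: measurable_absfdf.
- by apply: emeasurable_funD; exact: measurable_sqr.
move=> x _; rewrite -EFinD lee_fin normrM -(real_normK (num_real (f x))).
rewrite -(real_normK (num_real (partial i f x))) -subr_ge0.
rewrite (_ : _ - _ = (`|f x| - `|partial i f x|) ^+ 2)%R ?sqr_ge0//.
by ring.
Qed.

Lemma integral_absfdf_sqr_le d (f : 'rV[R]_d -> R) i : C1c f ->
  (\int[lebesgue_rV R d]_x absfdf f i x) * (\int[lebesgue_rV R d]_x absfdf f i x) <=
  4%:E * ((\int[lebesgue_rV R d]_x (f x ^+ 2)%:E) *
          (\int[lebesgue_rV R d]_x (partial i f x ^+ 2)%:E)).
Proof.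
move=> Cf; have [cf _ cdf _] := Cf.
have mf := continuous_measurable_rV cf.
have mdf := continuous_measurable_rV (cdf i).
rewrite (_ : \int[_]_x absfdf f i x =
    2%:E * \int[lebesgue_rV R d]_x (`|f x * partial i f x|)%:E); last first.
  rewrite -ge0_integralZl_EFin//.
  by apply/measurable_EFinP; apply: measurableT_comp => //; exact: measurable_funM.
rewrite muleACA -EFinM (_ : (2 * 2 = 4 :> R)%R); last by rewrite -natrM.
by apply: lee_wpmul2l => //; exact: cauchy_schwarz_abs.
Qed.

(** The product is at most the square of the larger factor, to which Cauchy-Schwarz applies; either
    squared partial derivative is at most the sum of both. This avoids square roots of extended
    reals. *)
Lemma integral_absfdf_prod_le d (f : 'rV[R]_d -> R) i j : C1c f ->
  (\int[lebesgue_rV R d]_x absfdf f i x) * (\int[lebesgue_rV R d]_x absfdf f j x) <=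
  4%:E * (\int[lebesgue_rV R d]_x (f x ^+ 2)%:E) *
  \int[lebesgue_rV R d]_x ((partial i f x ^+ 2)%:E + (partial j f x ^+ 2)%:E).
Proof.
move=> Cf; have [cf _ cdf _] := Cf.
pose G (x : 'rV[R]_d) := (partial i f x ^+ 2)%:E + (partial j f x ^+ 2)%:E.
have mG : measurable_fun setT G by apply: emeasurable_funD; exact: measurable_sqr.
have I0 := int_sqr_ge0 f.
have A0 k : 0 <= \int[lebesgue_rV R d]_x absfdf f k x.
  by apply: integral_ge0 => x _; exact: absfdf_ge0.
have main k : (forall x, (partial k f x ^+ 2)%:E <= G x) ->
    (\int[lebesgue_rV R d]_x absfdf f k x) *
    (\int[lebesgue_rV R d]_x absfdf f k x) <=
    4%:E * (\int[lebesgue_rV R d]_x (f x ^+ 2)%:E) * \int[lebesgue_rV R d]_x G x.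
  move=> kG; apply: le_trans (integral_absfdf_sqr_le _ Cf) _.
  rewrite -muleA; apply: lee_wpmul2l => //; apply: lee_wpmul2l => //.
  apply: ge0_le_integral => //.
  - by move=> x _; rewrite lee_fin sqr_ge0.
  - exact: measurable_sqr.
have [leij|/ltW leji] := leP (\int[lebesgue_rV R d]_x absfdf f i x)
    (\int[lebesgue_rV R d]_x absfdf f j x).
  apply: le_trans (main j _); first exact: lee_wpmul2r.
  by move=> x; rewrite leeDr// lee_fin sqr_ge0.
apply: le_trans (main i _); first exact: lee_wpmul2l.
by move=> x; rewrite leeDl// lee_fin sqr_ge0.
Qed.

Lemma integral_absfdf_slice_le d (f : 'rV[R]_d.+1 -> R) (a : R) i j : C1c f ->
  (\int[lebesgue_rV R d]_x absfdf (fun y => f (rV_cons (a, y))) i x) *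
  (\int[lebesgue_rV R d]_x absfdf (fun y => f (rV_cons (a, y))) j x) <=
  4%:E * (\int[lebesgue_rV R d]_y (f (rV_cons (a, y)) ^+ 2)%:E) *
  \int[lebesgue_rV R d]_y ((partial (lift ord0 i) f (rV_cons (a, y)) ^+ 2)%:E +
                           (partial (lift ord0 j) f (rV_cons (a, y)) ^+ 2)%:E).
Proof.
move=> /(C1c_slice a)/(integral_absfdf_prod_le i j).
have E k : partial k (fun y => f (rV_cons (a, y))) =
    (fun y => partial (lift ord0 k) f (rV_cons (a, y))).
  by apply/funext => y; rewrite partial_slice.
by rewrite (E i) (E j).
Qed.

Lemma C1c_sqr_le_cons d (f : 'rV[R]_d.+1 -> R) a y : C1c f ->
  (f (rV_cons (a, y)) ^+ 2)%:E <= \int[leb]_t absfdf f ord0 (rV_cons (t, y)).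
Proof.
move=> Cf; have := @C1c_sqr_le _ _ f ord0 (rV_cons (0%R, y)) a Cf.
rewrite rV_cons_line0 add0r => /le_trans; apply.
rewrite le_eqVlt; apply/orP; left; apply/eqP; apply: eq_integral => t _.
by rewrite rV_cons_line0 add0r.
Qed.

(** The squared [L^2] norm of every slice is at most [D], whatever [a], since [f^2] at a point is
    bounded by the integral of [absfdf f ord0] along its line in the first direction. The constant
    [4 D] then leaves the integral over the slices. *)
Lemma integral_slices_le d (f : 'rV[R]_d.+1 -> R) (G : 'rV[R]_d.+1 -> \bar R) :
  C1c f -> measurable_fun setT G -> (forall x, 0 <= G x) ->
  (forall a, \int[lebesgue_rV R d]_y (f (rV_cons (a, y)) ^+ 4)%:E <=
    4%:E * (\int[lebesgue_rV R d]_y (f (rV_cons (a, y)) ^+ 2)%:E) *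
    \int[lebesgue_rV R d]_y G (rV_cons (a, y))) ->
  \int[lebesgue_rV R d.+1]_x (f x ^+ 4)%:E <=
  4%:E * (\int[lebesgue_rV R d.+1]_x absfdf f ord0 x *
          \int[lebesgue_rV R d.+1]_x G x).
Proof.
move=> Cf mG G0 fG; have [cf _ _ _] := Cf.
have mf := continuous_measurable_rV cf.
have mf2 : measurable_fun setT (fun x => (f x ^+ 2)%:E) by exact: measurable_sqr.
have mf4 : measurable_fun setT (fun x => (f x ^+ 4)%:E).
  by apply/measurable_EFinP; exact: measurable_funX.
have f40 x : 0 <= (f x ^+ 4)%:E by rewrite lee_fin exprn_even_ge0.
have f20 x : 0 <= (f x ^+ 2)%:E by rewrite lee_fin sqr_ge0.
have mA := measurable_absfdf ord0 Cf; have A0 := absfdf_ge0 f ord0.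
set D := \int[_]_x absfdf f ord0 x.
have D0 : 0 <= D by exact: integral_ge0.
pose H (a : measurableTypeR R) := \int[lebesgue_rV R d]_y G (rV_cons (a, y)).
have H0 a : 0 <= H a by exact: integral_ge0.
have mH : measurable_fun setT H by exact: measurable_integral_cons1.
have sliceD a : \int[lebesgue_rV R d]_y (f (rV_cons (a, y)) ^+ 2)%:E <= D.
  rewrite /D (integral_rV_cons2 mA A0); apply: ge0_le_integral => //.
  - exact: (measurable_cons1 a mf2).
  - exact: measurable_integral_cons2.
  by move=> y _; exact: C1c_sqr_le_cons.
rewrite (integral_rV_cons1 mf4 f40) (integral_rV_cons1 mG G0) -/H muleA.
rewrite -(ge0_integralZl _ _ mH)//; last by rewrite mule_ge0.
apply: ge0_le_integral => //.
- by move=> a _; exact: integral_ge0.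
- exact: (measurable_integral_cons1 mf4 f40).
- exact: measurable_funeM.
move=> a _; apply: le_trans (fG a) _.
by apply: lee_wpmul2r; [exact: H0|apply: lee_wpmul2l].
Qed.

Lemma integral_partial2_le d (f : 'rV[R]_d -> R) i j : C1c f -> i != j ->
  \int[lebesgue_rV R d]_x ((partial i f x ^+ 2)%:E + (partial j f x ^+ 2)%:E) <=
  h1e f.
Proof.
move=> Cf ij; have [cf _ cdf _] := Cf.
rewrite ge0_integralD//; last 4 first.
- by move=> x _; rewrite lee_fin sqr_ge0.
- exact: measurable_sqr.
- by move=> x _; rewrite lee_fin sqr_ge0.
- exact: measurable_sqr.
rewrite /h1e (bigD1 i)//= (bigD1 j)//=; last by rewrite eq_sym.
apply: le_trans (leeDr _ (int_sqr_ge0 f)).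
by apply: leeD; [exact: lexx|apply: leeDl; exact: sume_ge0].
Qed.

(** Write [f^4] as [f^2 f^2] and bound one factor along the line in the first direction, the other
    along the line in the second; each bound is independent of the coordinate integrated out. *)
Lemma ladyzhenskaya2_prod (f : 'rV[R]_2 -> R) : C1c f ->
  \int[lebesgue_rV R 2]_x (f x ^+ 4)%:E <=
  (\int[lebesgue_rV R 2]_x absfdf f ord0 x) *
  (\int[lebesgue_rV R 2]_x absfdf f (lift ord0 ord0) x).
Proof.
move=> Cf; have [cf _ _ _] := Cf.
have mf := continuous_measurable_rV cf.
have f2E a (y : 'rV[R]_1) : (f (rV_cons (a, y)) ^+ 2)%:E <=
    \int[lebesgue_rV R 1]_z absfdf f (lift ord0 ord0) (rV_cons (a, z)).
  pose z : 'rV[R]_0 := 0%R.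
  (* A vector of [R^1] is its coordinate followed by the empty vector, so the bound along the first
     direction applies to the slice. *)
  have -> : y = rV_cons (y ord0 ord0, z).
    by apply/rowP => i; rewrite ord1 rV_consE0.
  have := @C1c_sqr_le_cons _ _ (y ord0 ord0) z (C1c_slice a Cf).
  move=> /le_trans; apply; rewrite (integral_rV1 z).
  - rewrite le_eqVlt; apply/orP; left; apply/eqP; apply: eq_integral => t _.
    by rewrite /absfdf partial_slice.
  - exact: measurable_cons1 (measurable_absfdf _ Cf).
  - by move=> x; exact: absfdf_ge0.
apply: integral_prod_le.
- by apply/measurable_EFinP; exact: measurable_funX.
- by move=> x; rewrite lee_fin exprn_even_ge0.
- exact: measurable_absfdf.
- exact: absfdf_ge0.
- exact: measurable_absfdf.
- exact: absfdf_ge0.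
move=> a y; rewrite (_ : (_ ^+ 4)%:E =
    (f (rV_cons (a, y)) ^+ 2)%:E * (f (rV_cons (a, y)) ^+ 2)%:E); last first.
  by rewrite -EFinM -exprD.
apply: lee_pmul; rewrite ?lee_fin ?sqr_ge0//.
exact: C1c_sqr_le_cons.
Qed.

Lemma ladyzhenskaya2 (f : 'rV[R]_2 -> R) : C1c f ->
  \int[lebesgue_rV R 2]_x (f x ^+ 4)%:E <= 4%:E * (h1e f * h1e f).
Proof.
move=> Cf; apply: le_trans (ladyzhenskaya2_prod Cf) _.
apply: (@le_trans _ _ (h1e f * h1e f)).
  apply: lee_pmul; [| |exact: integral_absfdf_le|exact: integral_absfdf_le].
  - by apply: integral_ge0 => x _; exact: absfdf_ge0.
  - by apply: integral_ge0 => x _; exact: absfdf_ge0.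
(* The constant 4 is the one of dimension three, so that both dimensions share a bound. *)
rewrite -[leLHS]mul1e; apply: lee_wpmul2r; first by rewrite mule_ge0// h1e_ge0.
by rewrite lee_fin ler1n.
Qed.

(** The planar inequality holds on each slice, with [G] the squared gradient within the plane;
    [integral_slices_le] integrates it over the slices. *)
Lemma ladyzhenskaya3 (f : 'rV[R]_3 -> R) : C1c f ->
  \int[lebesgue_rV R 3]_x (f x ^+ 4)%:E <= 4%:E * (h1e f * h1e f).
Proof.
move=> Cf; have [cf _ cdf _] := Cf.
pose i1 : 'I_3 := lift ord0 ord0; pose i2 : 'I_3 := lift ord0 (lift ord0 ord0).
pose G (x : 'rV[R]_3) := (partial i1 f x ^+ 2)%:E + (partial i2 f x ^+ 2)%:E.
have G0 x : 0 <= G x by rewrite adde_ge0// lee_fin sqr_ge0.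
have mG : measurable_fun setT G by apply: emeasurable_funD; exact: measurable_sqr.
have slice4 (a : R) : \int[lebesgue_rV R 2]_y (f (rV_cons (a, y)) ^+ 4)%:E <=
    4%:E * (\int[lebesgue_rV R 2]_y (f (rV_cons (a, y)) ^+ 2)%:E) *
    \int[lebesgue_rV R 2]_y G (rV_cons (a, y)).
  apply: le_trans (ladyzhenskaya2_prod (C1c_slice a Cf)) _.
  exact: integral_absfdf_slice_le.
apply: le_trans (integral_slices_le Cf mG G0 slice4) _.
apply: lee_wpmul2l; first by rewrite lee_fin.
apply: lee_pmul.
- by apply: integral_ge0 => x _; exact: absfdf_ge0.
- by apply: integral_ge0 => x _; exact: G0.
- exact: integral_absfdf_le.
- exact: integral_partial2_le.
Qed.

End ladyzhenskaya.

(** * Test functions *)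

Section smooth_mul.
Context (R : realType) (d : nat).
Implicit Types f g : 'rV[R]_d -> R.

Let regular f := continuous f /\ forall i x, derivable f x (delta_mx ord0 i).

(** [smooth] speaks of all lists of partial derivatives; this recursive form, graded by the order,
    allows an induction with Leibniz's rule. *)
Fixpoint Ck (n : nat) f : Prop :=
  regular f /\ if n is n'.+1 then forall i, Ck n' (partial i f) else True.

Let Ck_regular n f : Ck n f -> regular f.
Proof. by case: n => [|n] []. Qed.

Let CkW n f : Ck n.+1 f -> Ck n f.
Proof.
elim: n f => [|n IH] f [rf df]; split => //= i.
by apply: IH; exact: df.
Qed.

Lemma smooth_Ck f : smooth f <-> forall n, Ck n f.
Proof.
split=> [sf n|Cf].
  elim: n f sf => [|n IH] f sf; split; try exact: (sf [::]).
    by [].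
  (* In [foldr] the last entry of the list is differentiated first, hence [rcons]. *)
  by move=> i; apply: IH => s; have := sf (rcons s i); rewrite foldr_rcons.
move=> s /=; have : Ck (size s) f by [].
elim/last_ind: s {Cf} f => [|s i IH] f; first by move=> [].
by rewrite size_rcons foldr_rcons => -[_ /(_ i)]; exact: IH.
Qed.

Let partialD f g i : regular f -> regular g ->
  partial i (f \+ g) = partial i f \+ partial i g.
Proof.
by move=> [_ df] [_ dg]; apply/funext => x; exact: deriveD.
Qed.

Lemma partialM f g i :
  (forall x, derivable f x (delta_mx ord0 i)) ->
  (forall x, derivable g x (delta_mx ord0 i)) ->
  partial i (f \* g) = (f \* partial i g) \+ (g \* partial i f).
Proof. by move=> df dg; apply/funext => x; exact: deriveM. Qed.

Let CkD n f g : Ck n f -> Ck n g -> Ck n (f \+ g).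
Proof.
elim: n f g => [|n IH] f g Cf Cg; have [cf df] := Ck_regular Cf;
    have [cg dg] := Ck_regular Cg.
  by split=> //; split=> [x|i x]; [exact: continuousD (cf x) (cg x)|exact: derivableD].
split; first by split=> [x|i x]; [exact: continuousD (cf x) (cg x)|exact: derivableD].
move=> i; rewrite partialD//; apply: IH; first by case: Cf => _ /(_ i).
by case: Cg => _ /(_ i).
Qed.

Let CkM n f g : Ck n f -> Ck n g -> Ck n (f \* g).
Proof.
elim: n f g => [|n IH] f g Cf Cg; have [cf df] := Ck_regular Cf;
    have [cg dg] := Ck_regular Cg.
  by split=> //; split=> [x|i x]; [exact: continuousM (cf x) (cg x)|exact: derivableM].
split; first by split=> [x|i x]; [exact: continuousM (cf x) (cg x)|exact: derivableM].
move=> i; rewrite partialM//; apply: CkD; apply: IH; try exact: CkW.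
  by case: Cg => _ /(_ i).
by case: Cf => _ /(_ i).
Qed.

Lemma smoothM f g : smooth f -> smooth g -> smooth (f \* g).
Proof. by move=> /smooth_Ck Cf /smooth_Ck Cg; apply/smooth_Ck => n; exact: CkM. Qed.

End smooth_mul.

Section test_functions.
Context (R : realType) (d : nat) (Omega : set 'rV[R]_d).
Implicit Types phi psi f : 'rV[R]_d -> R.

Lemma continuous_bounded_support f (M : R) : continuous f ->
  (forall x, M < `|x| -> f x = 0) -> exists K, forall x, `|f x| <= K.
Proof.
move=> cf f0.
have cB : compact [set x : 'rV[R]_d | `|x| <= M].
  apply: bounded_closed_compact.
    by exists M; split; [exact: num_real|move=> N MN x /= /le_trans; apply; exact: ltW].
  rewrite (_ : [set _ | _] = Num.norm @^-1` [set r | r <= M]); last by [].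
  by apply: closed_comp; [move=> x _; exact: norm_continuous|exact: closed_le].
have := continuous_compact (continuous_subspaceT cf) cB.
move=> /compact_bounded[K [_ /(_ (`|K| + 1))]] H.
have {}H x : `|x| <= M -> `|f x| <= `|K| + 1.
  by move=> xM; apply: H; [have := ler_norm K; lra|exists x].
exists (`|K| + 1) => x; have [xM|/f0 ->] := leP `|x| M; first exact: H.
by rewrite normr0 addr_ge0.
Qed.

(** What the [L^4] estimates keep of a test function. Vanishing off [Omega] makes integrals over
    [Omega] and over the whole space agree, and differences stay in the class. *)
Definition C1c_in f :=
  C1c f /\ forall x, ~ Omega x -> f x = 0 /\ forall i, partial i f x = 0.

Lemma test_function_C1c_in phi : test_function Omega phi -> C1c_in phi.
Proof.
case=> sphi cphi phiO.
set S := closure [set x | phi x != 0] in cphi phiO.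
have phi0 x : ~ S x -> phi x = 0.
  move=> Sx; apply/eqP/negP => phix; apply: Sx; apply: subset_closure.
  exact/negP.
split.
- split.
  + by have [] := sphi [::].
  + by have [] := sphi [::].
  + by move=> i; have [] := sphi [:: i].
  + have [M [_ SM]] := compact_bounded cphi.
    exists (`|M| + 1) => x Mx; apply: phi0 => Sx.
    have /SM/(_ _ Sx) : M < `|M| + 1 by have := ler_norm M; lra.
    by rewrite /= leNgt Mx.
- move=> x Ox; have Sx : ~ S x by move=> /phiO.
  split=> [|i]; first exact: phi0.
  rewrite /partial (@near_eq_derive _ _ _ phi (cst 0)) ?derive_cst//.
  have : open (~` S) by apply: closed_openC; exact: closed_closure.
  rewrite openE => /(_ x Sx); rewrite /interior /=; apply: filterS => y.
  exact: phi0.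
Qed.

(** With [psi = phi], this lets [phi^2] be used in the definition of weak derivatives. *)
Lemma test_functionM phi psi :
  test_function Omega phi -> smooth psi -> test_function Omega (phi \* psi).
Proof.
case=> sphi cphi phiO spsi.
have sub : closure [set x | (phi \* psi) x != 0] `<=` closure [set x | phi x != 0].
  apply: closureS => x /=; apply: contra => /eqP ->.
  by rewrite mul0r.
split; first exact: smoothM.
  exact: subclosed_compact (@closed_closure _ _) cphi sub.
by move=> x /sub; exact: phiO.
Qed.

Lemma C1c_bounded f : C1c f ->
  exists K, forall x, `|f x| <= K /\ forall i, `|partial i f x| <= K.
Proof.
case=> cf df cdf [M f0].
have [K fK] := continuous_bounded_support cf f0.
have /choice[K' fK'] i : exists K, forall x, `|partial i f x| <= K.
  by apply: (continuous_bounded_support (M := M) (cdf i)) => x; exact: partial_eq0.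
exists (K + \sum_i `|K' i|) => x; split=> [|i].
  by apply: le_trans (fK x) _; rewrite lerDl sumr_ge0.
apply: le_trans (fK' i x) _; apply: le_trans (ler_norm _) _.
rewrite (bigD1 i)//= addrCA lerDl addr_ge0//; last by rewrite sumr_ge0.
exact: le_trans (fK x).
Qed.

Lemma C1cB f g : C1c f -> C1c g -> C1c (f \- g) /\
  forall i, partial i (f \- g) = partial i f \- partial i g.
Proof.
case=> cf df cdf [M f0] [cg dg cdg [N g0]].
have E i : partial i (f \- g) = partial i f \- partial i g.
  by apply/funext => x; exact: deriveB.
split=> //; split.
- by move=> x; exact: continuousB (cf x) (cg x).
- by move=> i x; exact: derivableB.
- by move=> i; rewrite E => x; exact: continuousB (cdf i x) (cdg i x).
- exists (Num.max M N) => x; rewrite gt_max => /andP[Mx Nx].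
  by rewrite /= f0// g0// subrr.
Qed.

Lemma C1c_inB f g : C1c_in f -> C1c_in g -> C1c_in (f \- g).
Proof.
move=> [Cf f0] [Cg g0]; have [C E] := C1cB Cf Cg; split=> // x Ox.
have [fx dfx] := f0 x Ox; have [gx dgx] := g0 x Ox.
by split=> [|i]; rewrite ?E/= ?fx ?gx ?dfx ?dgx subrr.
Qed.

End test_functions.

(** * Square-integrable functions *)

Section L2_space.
Context (R : realType) (d : nat) (Omega : set 'rV[R]_d).
Hypothesis mO : measurable Omega.
Local Notation mu := (lebesgue_rV R d).
Implicit Types f g h : 'rV[R]_d -> R.
Local Notation L2 := (L2 Omega).
Local Notation ip := (ip Omega).

Lemma le_integrable_EFin f g : measurable_fun Omega f ->
  (forall x, Omega x -> `|f x| <= g x) ->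
  mu.-integrable Omega (EFin \o g) -> mu.-integrable Omega (EFin \o f).
Proof.
move=> mf fg; apply: le_integrable => //; first exact/measurable_EFinP.
by move=> x Ox; rewrite /= lee_fin; apply: le_trans (fg x Ox) (ler_norm _).
Qed.

Lemma L2_mul_integrable f g :
  L2 f -> L2 g -> mu.-integrable Omega (fun x => (f x * g x)%:E).
Proof.
move=> [mf if2] [mg ig2].
apply: (@le_integrable_EFin _ (fun x => f x ^+ 2 + g x ^+ 2)).
- exact: measurable_funM.
- move=> x _; rewrite normrM -(real_normK (num_real (f x))).
  rewrite -(real_normK (num_real (g x))).
  by have := sqr_ge0 (`|f x| - `|g x|); have := sqr_ge0 (`|f x| + `|g x|); nra.
- rewrite (_ : _ \o _ = (fun x => (f x ^+ 2)%:E) \+ (fun x => (g x ^+ 2)%:E))//.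
  exact: integrableD.
Qed.

Lemma L2D f g : L2 f -> L2 g -> L2 (fun x => f x + g x).
Proof.
move=> [mf if2] [mg ig2]; split; first exact: measurable_funD.
apply: (@le_integrable_EFin _ (fun x => 2 * (f x ^+ 2 + g x ^+ 2))).
- by apply: measurable_funX; exact: measurable_funD.
- move=> x _; rewrite ger0_norm ?sqr_ge0//.
  by have := sqr_ge0 (f x - g x); nra.
- rewrite (_ : _ \o _ = (fun x => 2%:E * ((f x ^+ 2)%:E + (g x ^+ 2)%:E))%E)//.
  by apply: integrableZl => //; exact: integrableD.
Qed.

Lemma L2Z (k : R) f : L2 f -> L2 (fun x => k * f x).
Proof.
move=> [mf if2]; split; first by apply: measurable_funM => //; exact: measurable_cst.
under eq_fun do rewrite exprMn EFinM.
exact: integrableZl.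
Qed.

Lemma L2N f : L2 f -> L2 (fun x => - f x).
Proof. by move=> /(L2Z (-1)); under eq_fun do rewrite mulN1r. Qed.

Lemma L2B f g : L2 f -> L2 g -> L2 (fun x => f x - g x).
Proof. by move=> Lf /L2N; exact: L2D. Qed.

Lemma ipC f g : ip f g = ip g f.
Proof. by apply: eq_Rintegral => x _; rewrite mulrC. Qed.

Lemma ipDl f g h : L2 f -> L2 g -> L2 h ->
  ip (fun x => f x + g x) h = ip f h + ip g h.
Proof.
move=> Lf Lg Lh; rewrite /Defs.ip; under eq_Rintegral do rewrite mulrDl.
by rewrite RintegralD//; exact: L2_mul_integrable.
Qed.

Lemma ipZl (k : R) f h : L2 f -> L2 h -> ip (fun x => k * f x) h = k * ip f h.
Proof.
move=> Lf Lh; rewrite /Defs.ip; under eq_Rintegral do rewrite -mulrA.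
by rewrite RintegralZl//; exact: L2_mul_integrable.
Qed.

Lemma ipNl f h : L2 f -> L2 h -> ip (fun x => - f x) h = - ip f h.
Proof.
by move=> Lf Lh; rewrite -mulN1r -ipZl//; under [in RHS]eq_fun do rewrite mulN1r.
Qed.

Lemma ipBl f g h : L2 f -> L2 g -> L2 h ->
  ip (fun x => f x - g x) h = ip f h - ip g h.
Proof. by move=> Lf Lg Lh; rewrite ipDl ?ipNl//; exact: L2N. Qed.

Lemma ipDr f g h : L2 f -> L2 g -> L2 h ->
  ip h (fun x => f x + g x) = ip h f + ip h g.
Proof. by move=> *; rewrite ipC ipDl// ![ip _ h]ipC. Qed.

Lemma ipBr f g h : L2 f -> L2 g -> L2 h ->
  ip h (fun x => f x - g x) = ip h f - ip h g.
Proof. by move=> *; rewrite ipC ipBl// ![ip _ h]ipC. Qed.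

Lemma ipZr (k : R) f h : L2 f -> L2 h -> ip h (fun x => k * f x) = k * ip h f.
Proof. by move=> *; rewrite ipC ipZl// ![ip _ h]ipC. Qed.

Lemma ip_ge0 f : 0 <= ip f f.
Proof. by apply: Rintegral_ge0 => x _; rewrite -expr2 sqr_ge0. Qed.

Lemma cauchy_schwarz_ip f g : L2 f -> L2 g -> ip f g ^+ 2 <= ip f f * ip g g.
Proof.
move=> Lf Lg.
have quad s : 0 <= ip f f + s * (2 * ip f g) + s ^+ 2 * ip g g.
  have Lsg := L2Z s Lg.
  have := ip_ge0 (fun x => f x + s * g x).
  rewrite ipDl//; last exact: L2D.
  rewrite !ipDr// (ipC (fun x => s * g x) f) ipZr// ipZl//.
  rewrite ipZr//; congr (0 <= _); ring.
have := ip_ge0 g; rewrite le_eqVlt => /predU1P[g0|g_gt0].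
  have [->|fg0] := eqVneq (ip f g) 0; first by rewrite expr0n mulr_ge0// ip_ge0.
  (* If [|g| = 0] the quadratic is affine in [s], and this [s] would give it the value -1. *)
  have := quad (- (ip f f + 1) / (2 * ip f g)).
  by rewrite -g0 !mulr0 addr0 divfK ?mulf_neq0//; lra.
(* The minimiser of the quadratic. *)
have := quad (- (ip f g / ip g g)).
rewrite -(ler_pM2r g_gt0) mul0r.
suff -> : (ip f f + - (ip f g / ip g g) * (2 * ip f g) +
    (- (ip f g / ip g g)) ^+ 2 * ip g g) * ip g g =
    ip f f * ip g g - ip f g ^+ 2 by rewrite subr_ge0.
by field; rewrite gt_eqF.
Qed.

Lemma ip_sqrD_le f g : L2 f -> L2 g ->
  ip (fun x => f x + g x) (fun x => f x + g x) <= 2 * ip f f + 2 * ip g g.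
Proof.
move=> Lf Lg; have := ip_ge0 (fun x => f x - g x).
have LD := L2D Lf Lg; have LB := L2B Lf Lg.
rewrite ipBl// !ipBr// ipDl// !ipDr// (ipC g f); lra.
Qed.

Lemma ip_sqrB_le f g : L2 f -> L2 g ->
  ip (fun x => f x - g x) (fun x => f x - g x) <= 2 * ip f f + 2 * ip g g.
Proof.
move=> Lf Lg; have := ip_sqrD_le Lf (L2N Lg).
have -> // : ip (fun x => - g x) (fun x => - g x) = ip g g.
by apply: eq_Rintegral => x _; rewrite mulrNN.
Qed.

Lemma integral_ipE f g : L2 f -> L2 g ->
  (\int[mu]_(x in Omega) (f x * g x)%:E = (ip f g)%:E)%E.
Proof.
by move=> Lf Lg; rewrite /Defs.ip /Rintegral fineK// integrable_fin_num//;
  exact: L2_mul_integrable.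
Qed.

(** Stated through [f^2] in [L^2], so that Hoelder's inequality in [L^4] becomes Cauchy-Schwarz for
    squares. *)
Definition L4 f := measurable_fun Omega f /\ L2 (fun x => f x ^+ 2).

Lemma L4_mul f g : L4 f -> L4 g -> L2 (fun x => f x * g x).
Proof.
move=> [mf f4] [mg g4]; split; first exact: measurable_funM.
by under eq_fun do rewrite exprMn; exact: L2_mul_integrable.
Qed.

Lemma L4_mul_ip_le f g : L4 f -> L4 g ->
  ip (fun x => f x * g x) (fun x => f x * g x) ^+ 2 <=
  ip (fun x => f x ^+ 2) (fun x => f x ^+ 2) *
  ip (fun x => g x ^+ 2) (fun x => g x ^+ 2).
Proof.
move=> [mf f4] [mg g4]; apply: le_trans (cauchy_schwarz_ip f4 g4).
rewrite le_eqVlt; apply/orP; left; apply/eqP; congr (_ ^+ 2).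
by apply: eq_Rintegral => x _; ring.
Qed.

Lemma L4D f g : L4 f -> L4 g -> L4 (fun x => f x + g x).
Proof.
move=> L4f L4g; have [mf f4] := L4f; have [mg g4] := L4g.
split; first exact: measurable_funD.
under eq_fun do rewrite sqrrD.
apply: L2D => //; apply: L2D => //; under eq_fun do rewrite mulr2n.
by apply: L2D; exact: L4_mul.
Qed.

(* The weak L^2 approximation suffices because of the pointwise bound
   [min(g^2,n)^2 <= 16 psi^4 + 4 n (g - psi)^2]: compare [|g|] with [2 |psi|]. *)
Lemma L4_of_L2_approx g (K : R) : measurable_fun Omega g ->
  (forall delta, 0 < delta -> exists psi,
    [/\ L4 psi, L2 (fun x => g x - psi x),
      ip (fun x => g x - psi x) (fun x => g x - psi x) < delta &
      ip (fun x => psi x ^+ 2) (fun x => psi x ^+ 2) <= K]) ->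
  L4 g /\ ip (fun x => g x ^+ 2) (fun x => g x ^+ 2) <= 16 * K.
Proof.
move=> mg approx.
pose h n x : R := Num.min (g x ^+ 2) n%:R ^+ 2.
have mh n : measurable_fun Omega (h n).
  apply: measurable_funX; apply: measurable_minr; first exact: measurable_funX.
  exact: measurable_cst.
have h_ge0 n x : (0 <= (h n x)%:E)%E by rewrite lee_fin sqr_ge0.
have int_h n : (\int[mu]_(x in Omega) (h n x)%:E <= (16 * K)%:E)%E.
  apply/lee_addgt0Pr => e e0.
  have n0 : 0 < 4 * n.+1%:R :> R by rewrite mulr_gt0.
  (* The tolerance [e / (4 (n+1))] cancels the factor in front of [(g - psi)^2]; [n+1] keeps it
     meaningful at [n = 0]. *)
  have [psi [psi4 Lgpsi dpsi psiK]] := approx _ (divr_gt0 e0 n0).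
  have [mpsi Lpsi2] := psi4.
  have i1 := L2_mul_integrable Lpsi2 Lpsi2.
  have i2 := L2_mul_integrable Lgpsi Lgpsi.
  apply: (@le_trans _ _ (\int[mu]_(x in Omega)
      (16%:E * (psi x ^+ 2 * psi x ^+ 2)%:E +
       (4 * n.+1%:R)%:E * ((g x - psi x) * (g x - psi x))%:E))%E).
    apply: ge0_le_integral => //.
    - exact/measurable_EFinP.
    - by apply: (measurable_int mu); apply: integrableD => //; exact: integrableZl.
    move=> x _; rewrite -!EFinM -EFinD lee_fin /h.
    set a := g x; set b := psi x.
    have m0 : 0 <= Num.min (a ^+ 2) n%:R by rewrite le_min sqr_ge0 ler0n.
    have ma : Num.min (a ^+ 2) n%:R <= a ^+ 2 by rewrite ge_min lexx.
    have mn : Num.min (a ^+ 2) n%:R <= n.+1%:R.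
      by rewrite ge_min ler_nat leqnSn orbT.
    have [ab|ab] := leP (a ^+ 2) (4 * b ^+ 2).
      have : Num.min (a ^+ 2) n%:R ^+ 2 <= (4 * b ^+ 2) ^+ 2.
        have b4 : 0 <= 4 * b ^+ 2 by apply: mulr_ge0 => //; exact: sqr_ge0.
        by rewrite ler_sqr ?nnegrE//; exact: le_trans ma ab.
      have : 0 <= 4 * n.+1%:R * ((a - b) * (a - b)) by rewrite mulr_ge0// -expr2 sqr_ge0.
      by nra.
    (* Here [|a| > 2|b|], so [|a - b| > |a|/2]. *)
    have a4 : a ^+ 2 <= 4 * ((a - b) * (a - b)).
      rewrite -[leLHS]real_normK ?num_real//.
      have : (2 * `|b|) ^+ 2 <= `|a| ^+ 2.
        by rewrite exprMn !real_normK ?num_real// -natrX; lra.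
      rewrite ler_sqr ?nnegrE ?mulr_ge0// => ba.
      have := lerB_dist a b; set c := `|a - b| => cb.
      have -> : (a - b) * (a - b) = c ^+ 2 by rewrite -expr2 /c real_normK ?num_real.
      rewrite -[4](_ : 2 ^+ 2 = _); last by rewrite -natrX.
      have c0 : 0 <= c by exact: normr_ge0.
      by rewrite -exprMn ler_sqr ?nnegrE ?mulr_ge0//; lra.
    have : Num.min (a ^+ 2) n%:R ^+ 2 <= n.+1%:R * (4 * ((a - b) * (a - b))).
      by rewrite expr2; apply: ler_pM => //; exact: le_trans a4.
    have : 0 <= 16 * (b ^+ 2 * b ^+ 2) by rewrite mulr_ge0// -expr2 sqr_ge0.
    by lra.
  rewrite integralD//; [|exact: integrableZl|exact: integrableZl].
  rewrite !integralZl// !integral_ipE// -!EFinM -!EFinD lee_fin.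
  apply: lerD; first by rewrite ler_pM2l.
  by rewrite mulrC -ler_pdivlMr// ltW.
(* The bound is uniform in the truncation level and [h n] increases to [g^4], so monotone
   convergence applies. *)
have int_g : (\int[mu]_(x in Omega) (g x ^+ 2 * g x ^+ 2)%:E <= (16 * K)%:E)%E.
  have limh x : limn (fun n => (h n x)%:E) = (g x ^+ 2 * g x ^+ 2)%:E.
    apply: lim_near_cst => //; near=> n.
    rewrite /h min_l -?expr2//; near: n; exact: nbhs_infty_ger.
  under eq_integral do rewrite -limh.
  have nd x : Omega x -> {homo (fun n => (h n x)%:E) : n m / (n <= m)%N >-> (n <= m)%E}.
    move=> _ n m nm; rewrite lee_fin ler_sqr ?nnegrE ?le_min ?sqr_ge0 ?ler0n//.
    by rewrite ge_min lexx ge_min ler_nat nm orbT.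
  rewrite monotone_convergence//; last by move=> n; exact/measurable_EFinP.
  apply: lime_le; last by near=> n; exact: int_h.
  apply: ereal_nondecreasing_is_cvgn => n m nm.
  apply: ge0_le_integral => //; [exact/measurable_EFinP|exact/measurable_EFinP|].
  by move=> x Ox; exact: nd.
have L4g : L4 g.
  split=> //; split; first exact: measurable_funX.
  apply/integrableP; split.
    by apply/measurable_EFinP; do 2 apply: measurable_funX.
  apply: le_lt_trans (ltry (16 * K)); apply: le_trans int_g.
  rewrite le_eqVlt; apply/orP; left; apply/eqP; apply: eq_integral => x _.
  by rewrite gee0_abs ?lee_fin ?sqr_ge0// expr2.
by split=> //; rewrite -lee_fin -integral_ipE//; have [] := L4g.
Unshelve. all: by end_near. Qed.

Hypothesis finO : (mu Omega < +oo)%E.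

Lemma L2_bounded f (K : R) : measurable_fun Omega f ->
  (forall x, `|f x| <= K) -> L2 f.
Proof.
move=> mf fK; split=> //.
have mf2 : measurable_fun Omega (fun x => f x ^+ 2) by exact: measurable_funX.
apply: (measurable_bounded_integrable mO finO mf2).
exists (K ^+ 2); split; first exact: num_real.
move=> M KM x _; rewrite /= normrX; apply: le_trans (ltW KM).
by rewrite ler_sqr ?nnegrE//; exact: le_trans (fK x).
Qed.

Lemma L2_integrable f : L2 f -> mu.-integrable Omega (EFin \o f).
Proof.
move=> Lf; have L1 : L2 (cst 1).
  by apply: (@L2_bounded _ 1) => [|x]; rewrite ?normr1//; exact: measurable_cst.
have := L2_mul_integrable Lf L1.
by under eq_fun do rewrite mulr1.
Qed.

End L2_space.

(** * Functions in H^1_0 *)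

Lemma ladyzhenskaya (R : realType) (d : nat) (f : 'rV[R]_d -> R) :
  d = 2%N \/ d = 3%N -> C1c f ->
  (\int[lebesgue_rV R d]_x (f x ^+ 4)%:E <= 4%:E * (h1e f * h1e f))%E.
Proof.
by move=> d23; case: d23 f => -> f; [exact: ladyzhenskaya2|exact: ladyzhenskaya3].
Qed.

(** The bound is asked for [e <= 1] only, so that a product of small quantities may be estimated by
    a single factor [e]. *)
Lemma eq0_of_sqr_le (R : realType) (a K : R) :
  (forall e, 0 < e -> e <= 1 -> a ^+ 2 <= K * e) -> a = 0.
Proof.
move=> aK; apply/eqP; rewrite -sqrf_eq0 eq_le sqr_ge0 andbT.
apply/ler_addgt0Pr => e e0; rewrite add0r.
have K0 : 0 < `|K| + 1 by rewrite ltr_wpDl.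
have m0 : 0 < Num.min (e / (`|K| + 1)) 1 by rewrite lt_min divr_gt0/=.
have m1 : Num.min (e / (`|K| + 1)) 1 <= 1 by rewrite ge_min lexx orbT.
apply: le_trans (aK _ m0 m1) _.
have mK : Num.min (e / (`|K| + 1)) 1 * (`|K| + 1) <= e.
  by rewrite -ler_pdivlMr// ge_min lexx.
apply: le_trans mK; rewrite mulrC ler_pM2l//.
by have := ler_norm K; lra.
Qed.

Section sobolev.
Context (R : realType) (d : nat) (Omega : set 'rV[R]_d).
Hypothesis d23 : d = 2%N \/ d = 3%N.
Hypothesis mO : measurable Omega.
Hypothesis finO : (lebesgue_rV R d Omega < +oo)%E.
Local Notation mu := (lebesgue_rV R d).
Implicit Types f g h w phi : 'rV[R]_d -> R.
Local Notation L2 := (L2 Omega).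
Local Notation L4 := (L4 Omega).
Local Notation H10 := (H10 Omega).
Local Notation ip := (ip Omega).
Local Notation wpartial := (wpartial Omega).
Local Notation test_function := (test_function Omega).
Local Notation C1c_in := (C1c_in Omega).
Local Notation sqn f := (ip f f).
Local Notation sqn4 f := (sqn (fun x => f x ^+ 2)).

Lemma C1c_in_L2 f : C1c_in f -> L2 f /\ forall i, L2 (partial i f).
Proof.
move=> [Cf _]; have [K fK] := C1c_bounded Cf; have [cf _ cdf _] := Cf.
split=> [|i]; apply: (@L2_bounded _ _ _ mO finO _ K).
- exact: measurable_funS (continuous_measurable_rV cf).
- by move=> x; have [] := fK x.
- exact: measurable_funS (continuous_measurable_rV (cdf i)).
- by move=> x; have [_] := fK x.
Qed.

Lemma C1c_in_L4 f : C1c_in f -> L4 f.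
Proof.
move=> Cf; have [[Cf' _] [[mf _] _]] := (Cf, C1c_in_L2 Cf).
have [K fK] := C1c_bounded Cf'.
split=> //; apply: (@L2_bounded _ _ _ mO finO _ (K ^+ 2)).
  exact: measurable_funX.
move=> x; have [fx _] := fK x.
by rewrite normrX ler_sqr ?nnegrE//; exact: le_trans fx.
Qed.

(** The squared [H^1(Omega)] norm with the gradient [df] as separate data, since weak derivatives
    are chosen representatives: for [w - phi] the gradient is the difference of a chosen and a
    classical one. *)
Definition h1n f (df : 'I_d -> 'rV[R]_d -> R) : R := sqn f + \sum_i sqn (df i).

Lemma h1n_ge0 f df : 0 <= h1n f df.
Proof. by rewrite addr_ge0 ?ip_ge0 ?sumr_ge0// => i _; exact: ip_ge0. Qed.

Lemma sqn_le_h1n f df : sqn f <= h1n f df.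
Proof. by rewrite lerDl sumr_ge0// => i _; exact: ip_ge0. Qed.

Lemma sqn_partial_le_h1n f df i : sqn (df i) <= h1n f df.
Proof.
rewrite /h1n (bigD1 i)//= addrCA lerDl addr_ge0 ?ip_ge0 ?sumr_ge0// => j _.
exact: ip_ge0.
Qed.

Lemma h1nB_le f g df dg : L2 f -> L2 g ->
  (forall i, L2 (df i)) -> (forall i, L2 (dg i)) ->
  h1n (fun x => f x - g x) (fun i x => df i x - dg i x) <=
  2 * h1n f df + 2 * h1n g dg.
Proof.
move=> Lf Lg Ldf Ldg; rewrite /h1n !mulrDr addrACA; apply: lerD.
  exact: ip_sqrB_le.
by rewrite !mulr_sumr -big_split/=; apply: ler_sum => i _; exact: ip_sqrB_le.
Qed.

Lemma H1_dist2E f phi : H1_dist2 Omega f phi =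
  h1n (fun x => f x - phi x) (fun i x => wpartial i f x - partial i phi x).
Proof. by []. Qed.

Lemma wpartialP f i : H1 Omega f ->
  L2 (wpartial i f) /\ is_weak_partial Omega i f (wpartial i f).
Proof. by move=> [_ /(_ i)/(@xgetPex _ (fun=> 0))]. Qed.

Lemma h1e_C1c_in f : C1c_in f -> h1e f = (h1n f (fun i => partial i f))%:E.
Proof.
move=> Cf; have [Lf Ldf] := C1c_in_L2 Cf; have [_ f0] := Cf.
rewrite /h1e /h1n EFinD -sumEFin; congr (_ + _)%E.
  rewrite -integral_ipE// (@integral_outside0 _ _ _ _ Omega)//.
  by move=> x /f0[-> _]; rewrite expr0n.
apply: eq_bigr => i _.
rewrite -integral_ipE// (@integral_outside0 _ _ _ _ Omega)//.
by move=> x /f0[_ ->]; rewrite expr0n.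
Qed.

Lemma C1c_in_sqn4_le f : C1c_in f ->
  sqn4 f <= 4 * h1n f (fun i => partial i f) ^+ 2.
Proof.
move=> Cf; have [Cf' f0] := Cf; have [_ L4f] := C1c_in_L4 Cf.
rewrite -lee_fin -integral_ipE// expr2 !EFinM -h1e_C1c_in//.
apply: le_trans (ladyzhenskaya d23 Cf').
rewrite [leRHS](@integral_outside0 _ _ _ _ Omega); last first.
  by move=> x /f0[-> _]; rewrite expr0n.
rewrite le_eqVlt; apply/orP; left; apply/eqP; apply: eq_integral => x _.
by rewrite -exprD.
Qed.

(** If test functions [psi] tend to [w], then [psi - phi] tends to [w - phi] in [L^2], while its
    squared [H^1] norm stays below [4 e]. Ladyzhenskaya's inequality bounds it in [L^4], and
    [L4_of_L2_approx] passes this bound to [w - phi]. *)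
Lemma H10_L4_approx w e : H10 w -> 0 < e -> exists phi,
  [/\ test_function phi, H1_dist2 Omega w phi < e,
    L4 (fun x => w x - phi x) & sqn4 (fun x => w x - phi x) <= (32 * e) ^+ 2].
Proof.
move=> [H1w appr] e0.
have [phi [tphi dphi]] := appr _ e0.
have [Lw _] := H1w.
have Cphi := test_function_C1c_in tphi; have [Lphi Ldphi] := C1c_in_L2 Cphi.
exists phi.
(* Ladyzhenskaya gives [4 (4 e)^2] for [psi - phi]; the factor 16 lost in the limit makes it
   [(32 e)^2]. *)
have [] // := @L4_of_L2_approx _ _ _ mO (fun x => w x - phi x) (4 * (4 * e) ^+ 2).
- by have [] := L2B mO Lw Lphi.
- move=> delta delta0.
  (* Closeness [delta] serves the [L^2] approximation, closeness [e] the uniform [H^1] bound. *)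
  have de0 : 0 < Num.min delta e by rewrite lt_min delta0.
  have [psi [tpsi]] := appr _ de0.
  rewrite H1_dist2E lt_min => /andP[dpsi1 dpsi2].
  have Cpsi := test_function_C1c_in tpsi; have [Lpsi Ldpsi] := C1c_in_L2 Cpsi.
  have CB := C1c_inB Cpsi Cphi.
  exists (psi \- phi).
  have E : (fun x => w x - phi x - (psi \- phi) x) = (fun x => w x - psi x).
    by apply/funext => x /=; ring.
  split.
  + exact: C1c_in_L4.
  + by rewrite E; exact: L2B.
  + by rewrite E; apply: le_lt_trans dpsi1; exact: sqn_le_h1n.
  + apply: le_trans (C1c_in_sqn4_le CB) _.
    rewrite ler_pM2l// ler_sqr ?nnegrE ?h1n_ge0//; last by rewrite mulr_ge0// ltW.
    have dwL i : L2 (wpartial i w) by have [] := wpartialP i H1w.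
    have := @h1nB_le (fun x => w x - phi x) (fun x => w x - psi x)
      (fun i x => wpartial i w x - partial i phi x)
      (fun i x => wpartial i w x - partial i psi x)
      (L2B mO Lw Lphi) (L2B mO Lw Lpsi)
      (fun i => L2B mO (dwL i) (Ldphi i)) (fun i => L2B mO (dwL i) (Ldpsi i)).
    have -> : (fun x => w x - phi x - (w x - psi x)) = psi \- phi.
      by apply/funext => x /=; ring.
    have [_ dB] := C1cB Cpsi.1 Cphi.1.
    have -> : (fun i x => wpartial i w x - partial i phi x -
        (wpartial i w x - partial i psi x)) = (fun i => partial i (psi \- phi)).
      by apply/funext => i; rewrite dB; apply/funext => x /=; ring.
    move=> /le_trans; apply.
    have -> : 4 * e = 2 * e + 2 * e by ring.
    rewrite H1_dist2E in dphi.
    apply: lerD.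
      apply: ler_wpM2l; first exact: ler0n.
      exact: ltW dphi.
    apply: ler_wpM2l; first exact: ler0n.
    exact: ltW dpsi2.
- by move=> L4B sB; split=> //; apply: le_trans sB _; rewrite !exprMn; lra.
Qed.

Lemma H10_L4 w : H10 w -> L4 w.
Proof.
move=> Hw; have [phi [tphi _ L4B _]] := H10_L4_approx Hw ltr01.
have := L4D mO L4B (C1c_in_L4 (test_function_C1c_in tphi)).
by under eq_fun do rewrite subrK.
Qed.

(** True for test functions by integration along lines, and preserved by [L^2] limits because
    constants are in [L^2] on a set of finite measure. *)
Lemma integral_wpartial_eq0 w i : H10 w -> \int[mu]_(x in Omega) wpartial i w x = 0.
Proof.
move=> [H1w appr]; have [Lg _] := wpartialP i H1w.
have L1 : L2 (cst 1).
  by apply: (@L2_bounded _ _ _ mO finO _ 1) => [|x];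
    rewrite ?normr1//; exact: measurable_cst.
rewrite (_ : \int[mu]_(x in Omega) _ = ip (wpartial i w) (cst 1)); last first.
  by apply: eq_Rintegral => x _; rewrite mulr1.
apply: (@eq0_of_sqr_le _ _ (sqn (cst 1))) => e e0 _.
have [phi [tphi dphi]] := appr _ e0.
have Cphi := test_function_C1c_in tphi; have [Lphi Ldphi] := C1c_in_L2 Cphi.
have phi0 : ip (partial i phi) (cst 1) = 0.
  have [C phi0] := Cphi; have [_ _ cdphi _] := C.
  have iphi := L2_integrable mO finO (Ldphi i).
  have ip1 := integrable_funrpos mO iphi; have ip2 := integrable_funrneg mO iphi.
  rewrite (_ : ip _ _ = \int[mu]_(x in Omega)
      ((partial i phi)^\+ x - (partial i phi)^\- x)); last first.
    apply: eq_Rintegral => x _; rewrite mulr1.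
    by rewrite -[LHS](congr1 (fun F => F x) (funrposBneg (partial i phi))).
  rewrite RintegralB//; apply/eqP; rewrite subr_eq0; apply/eqP; congr fine.
  rewrite -!(@integral_outside0 _ _ _ _ Omega); first exact: C1c_integral_pos_neg.
  - by move=> x /phi0[_ h]; rewrite /funrneg h oppr0 maxxx.
  - by move=> x /phi0[_ h]; rewrite /funrpos h maxxx.
have LB := L2B mO Lg (Ldphi i).
rewrite -[X in X ^+ 2]subr0 -phi0 -ipBl//.
apply: le_trans (cauchy_schwarz_ip mO LB L1) _.
rewrite mulrC ler_wpM2l ?ip_ge0// ltW//; apply: le_lt_trans dphi.
rewrite H1_dist2E.
exact: (@sqn_partial_le_h1n _ (fun i x => wpartial i w x - partial i phi x) i).
Qed.

End sobolev.

(** * The convective term *)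

Lemma Rintegral_sum d (T : measurableType d) (R : realType)
    (mu : {measure set T -> \bar R}) (D : set T) (mD : measurable D)
    (I : Type) (s : seq I) (F : I -> T -> R) :
  (forall i, mu.-integrable D (EFin \o F i)) ->
  \int[mu]_(x in D) (\sum_(i <- s) F i x) = \sum_(i <- s) \int[mu]_(x in D) F i x.
Proof.
move=> iF; elim: s => [|i s IH].
  rewrite big_nil; under eq_Rintegral do rewrite big_nil.
  by rewrite Rintegral_cst// mul0r.
rewrite big_cons; under eq_Rintegral do rewrite big_cons.
rewrite RintegralD//; first by rewrite IH.
rewrite (_ : _ \o _ = (fun x => \sum_(j <- s) (F j x)%:E)%E).
  by apply: integrable_sum => // j _; exact: iF.
by apply/funext => x /=; rewrite sumEFin.
Qed.

(** * Inner products of square-integrable matrix fields *)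

Section L2_matrices.
Context (R : realType) (d : nat) (Omega : set 'rV[R]_d).
Hypothesis mO : measurable Omega.
Local Notation mu := (lebesgue_rV R d).
Local Notation ip := (ip Omega).
Local Notation L2 := (L2 Omega).

Lemma L2_sum (I : Type) (s : seq I) (F : I -> 'rV[R]_d -> R) :
  (forall i, L2 (F i)) -> L2 (fun x => \sum_(i <- s) F i x).
Proof.
move=> LF; elim: s => [|i s IH].
  under eq_fun do rewrite big_nil.
  split; first exact: measurable_cst.
  by under eq_fun do rewrite expr0n; exact: integrable0.
by under eq_fun do rewrite big_cons; exact: L2D.
Qed.

Lemma ip_suml (I : Type) (s : seq I) (F : I -> 'rV[R]_d -> R) h :
  (forall i, L2 (F i)) -> L2 h ->
  ip (fun x => \sum_(i <- s) F i x) h = \sum_(i <- s) ip (F i) h.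
Proof.
move=> LF Lh; rewrite /Defs.ip; under eq_Rintegral do rewrite mulr_suml.
rewrite (@Rintegral_sum _ _ _ mu _ mO _ s (fun i x => F i x * h x))// => i.
exact: L2_mul_integrable.
Qed.

Variables m n : nat.
Implicit Types F G H : 'rV[R]_d -> 'M[R]_(m, n).
Local Notation L2M := (L2M Omega).
Local Notation ipM := (ipM Omega).

Lemma Rintegral_sum2 (F : 'I_m -> 'I_n -> 'rV[R]_d -> R) :
  (forall i j, mu.-integrable Omega (EFin \o F i j)) ->
  \int[mu]_(x in Omega) (\sum_i \sum_j F i j x) =
  \sum_i \sum_j \int[mu]_(x in Omega) F i j x.
Proof.
move=> iF; rewrite (@Rintegral_sum _ _ _ mu _ mO _ _ (fun i x => \sum_j F i j x)).
  by apply: eq_bigr => i _; rewrite Rintegral_sum.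
move=> i; rewrite (_ : _ \o _ = (fun x => \sum_j (F i j x)%:E)%E).
  by apply: integrable_sum => // j _; exact: iF.
by apply/funext => x /=; rewrite sumEFin.
Qed.

Lemma ipME F G : L2M F -> L2M G ->
  ipM F G = \sum_i \sum_j ip (fun x => F x i j) (fun x => G x i j).
Proof.
move=> LF LG; rewrite /Defs.ipM /frob.
rewrite (@Rintegral_sum2 (fun i j x => F x i j * G x i j))// => i j.
exact: L2_mul_integrable.
Qed.

Lemma ipM_ge0 F : 0 <= ipM F F.
Proof.
apply: Rintegral_ge0 => x _; apply: sumr_ge0 => i _; apply: sumr_ge0 => j _.
by rewrite -expr2 sqr_ge0.
Qed.

Lemma normM_sqr F : normM Omega F ^+ 2 = ipM F F.
Proof. by rewrite /normM sqr_sqrtr// ipM_ge0. Qed.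

Lemma L2MB F G : L2M F -> L2M G -> L2M (fun x => F x - G x).
Proof.
move=> LF LG i j.
by under eq_fun do rewrite !mxE; exact: L2B.
Qed.

(** Entrywise, expand [|s f - g|^2 >= 0] and divide by [s]. *)
Lemma ipM_young F G (s : R) : 0 < s -> L2M F -> L2M G ->
  2 * ipM F G <= s * ipM F F + s^-1 * ipM G G.
Proof.
move=> s0 LF LG; rewrite !ipME// !mulr_sumr -big_split/=; apply: ler_sum => i _.
rewrite !mulr_sumr -big_split/=; apply: ler_sum => j _.
set f := fun x => F x i j; set g := fun x => G x i j.
have Lf : L2 f by exact: LF.
have Lg : L2 g by exact: LG.
have Lsf := L2Z mO s Lf.
have := ip_ge0 Omega (fun x => s * f x - g x).
have E1 : ip (fun x => s * f x) (fun x => s * f x) = s * (s * ip f f).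
  by rewrite ipZl// ipZr.
have E2 : ip (fun x => s * f x) g = s * ip f g by rewrite ipZl.
have LB := L2B mO Lsf Lg.
rewrite ipBl// !ipBr// [ip g (fun _ => _)]ipC E1 E2 => h.
rewrite -(ler_pM2l s0) mulrDr [s * (s^-1 * _)]mulrA divff ?gt_eqF// mul1r.
by move: h; lra.
Qed.

Lemma ipM_youngN F G : L2M F -> L2M G ->
  - (2 * ipM F G) <= ipM F F + ipM G G.
Proof.
move=> LF LG; rewrite !ipME// mulr_sumr -sumrN -big_split/=; apply: ler_sum => i _.
rewrite mulr_sumr -sumrN -big_split/=; apply: ler_sum => j _.
set f := fun x => F x i j; set g := fun x => G x i j.
have Lf : L2 f by exact: LF.
have Lg : L2 g by exact: LG.
have LD := L2D mO Lf Lg.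
have := ip_ge0 Omega (fun x => f x + g x).
by rewrite ipDl// !ipDr// (ipC _ g f); lra.
Qed.

Lemma ipMBr F G H : L2M F -> L2M G -> L2M H ->
  ipM H (fun x => F x - G x) = ipM H F - ipM H G.
Proof.
move=> LF LG LH; rewrite !ipME//; last exact: L2MB.
rewrite -sumrB; apply: eq_bigr => i _; rewrite -sumrB; apply: eq_bigr => j _.
rewrite -ipBr//.
by apply: eq_Rintegral => x _; rewrite !mxE.
Qed.

Lemma ipMC F G : ipM F G = ipM G F.
Proof.
by apply: eq_Rintegral => x _; do 2 (apply: eq_bigr => ? _); rewrite mulrC.
Qed.

Lemma ipMB_polar F G : L2M F -> L2M G ->
  2 * ipM (fun x => F x - G x) F =
  ipM F F - ipM G G + ipM (fun x => F x - G x) (fun x => F x - G x).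
Proof.
move=> LF LG; have LB := L2MB LF LG.
rewrite ipMBr// ![ipM (fun _ => _ - _) _]ipMC !ipMBr// (ipMC G F); ring.
Qed.

End L2_matrices.

(** * Vanishing of the convective form for divergence-free transport *)

Section convection.
Context (R : realType) (d : nat) (Omega : set 'rV[R]_d).
Hypothesis d23 : d = 2%N \/ d = 3%N.
Hypothesis mO : measurable Omega.
Hypothesis finO : (lebesgue_rV R d Omega < +oo)%E.
Local Notation mu := (lebesgue_rV R d).
Local Notation L2 := (L2 Omega).
Local Notation L4 := (L4 Omega).
Local Notation H10 := (H10 Omega).
Local Notation H10v := (H10v Omega).
Local Notation ip := (ip Omega).
Local Notation wpartial := (wpartial Omega).
Local Notation wdiv := (wdiv Omega).
Local Notation sqn f := (ip f f).
Local Notation sqn4 f := (sqn (fun x => f x ^+ 2)).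
Implicit Types (v : 'rV[R]_d -> 'cV[R]_d) (w phi : 'rV[R]_d -> R).

Lemma wdivE v :
  wdiv v = (fun x => \sum_i wpartial i (fun y => v y i ord0) x).
Proof. by apply/funext => x; apply: eq_bigr => i _; rewrite mxE. Qed.

Lemma H10_L2 w : H10 w -> L2 w. Proof. by case=> [[]]. Qed.

Lemma H10_wpartial w i : H10 w -> L2 (wpartial i w).
Proof. by move=> [H1w _]; have [] := wpartialP i H1w. Qed.

Lemma L2_wdiv v : H10v v -> L2 (wdiv v).
Proof.
by move=> Hv; rewrite wdivE; apply: L2_sum => // i; exact/H10_wpartial/Hv.
Qed.

(** Zero mean makes the divergence of a velocity itself an admissible [q] in the continuity
    equation. *)
Lemma wdiv_L20 v : H10v v -> L20 Omega (wdiv v).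
Proof.
move=> Hv; split; first exact: L2_wdiv.
rewrite wdivE (@Rintegral_sum _ _ _ mu _ mO _ _
  (fun i => wpartial i (fun y => v y i ord0))).
  by rewrite big1// => i _; apply: integral_wpartial_eq0 => //; exact: Hv.
by move=> i; apply: L2_integrable => //; exact/H10_wpartial/Hv.
Qed.

(** [2 phi d_j phi] is the derivative of the test function [phi^2], so the sum is minus half of
    [(div v, phi^2)], which is zero by Cauchy-Schwarz. Being divergence free is expressed by a zero
    norm, the form in which the scheme yields it. *)
Lemma test_convection_eq0 v phi : H10v v -> sqn (wdiv v) = 0 ->
  test_function Omega phi ->
  \sum_j ip (fun x => v x j ord0) (fun x => phi x * partial j phi x) = 0.
Proof.
move=> Hv divv tphi.
have Cphi := test_function_C1c_in tphi.
have [Lphi Ldphi] := C1c_in_L2 mO finO Cphi.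
have L4phi := C1c_in_L4 mO finO Cphi; have [_ Lphi2] := L4phi.
have [sphi _ _] := tphi; have [_ dphi] := sphi [::].
have [[cphi _ cdphi _] _] := Cphi.
have [K phiK] := C1c_bounded Cphi.1.
have Lpd j : L2 (fun x => phi x * partial j phi x).
  apply: (@L2_bounded _ _ _ mO finO _ (K * K)).
    by apply: measurable_funM; apply: measurable_funS (continuous_measurable_rV _).
  by move=> x; have [h1 h2] := phiK x; rewrite normrM; apply: ler_pM.
have weak j : 2 * ip (fun x => v x j ord0) (fun x => phi x * partial j phi x) =
    - ip (wpartial j (fun y => v y j ord0)) (fun x => phi x ^+ 2).
  have [_ weak] := wpartialP j (Hv j).1.
  have := weak _ (test_functionM tphi sphi).
  rewrite partialM// => E.
  have -> : (fun x => phi x ^+ 2) = phi \* phi by apply/funext => x; rewrite expr2.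
  rewrite -E -ipZr//; last exact: H10_L2 (Hv j).
  by congr (ip _ _); apply/funext => x /=; ring.
have div0 : ip (wdiv v) (fun x => phi x ^+ 2) = 0.
  apply/eqP; rewrite -sqrf_eq0 eq_le sqr_ge0 andbT.
  by apply: le_trans (cauchy_schwarz_ip mO (L2_wdiv Hv) Lphi2) _; rewrite divv mul0r.
move: div0; rewrite wdivE ip_suml//; last by move=> i; exact/H10_wpartial/Hv.
move=> /eqP; rewrite -oppr_eq0 -sumrN; under eq_bigr do rewrite -weak.
by rewrite -mulr_sumr mulf_eq0 pnatr_eq0/= => /eqP.
Qed.

(** Approximate [w] by test functions [phi], for which the form vanishes, with an error of order
    [sqrt e]. Only [w] is approximated: [v] enters through its [L^4] bounds and stays divergence
    free. *)
Lemma convection_eq0 v w : H10v v -> sqn (wdiv v) = 0 -> H10 w ->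
  \sum_j ip (wpartial j w) (fun x => v x j ord0 * w x) = 0.
Proof.
move=> Hv divv Hw.
have L4w := H10_L4 d23 mO finO Hw.
have L4v j : L4 (fun x => v x j ord0) by exact: (H10_L4 d23 mO finO (Hv j)).
have Lw := H10_L2 Hw; have Ldw j := H10_wpartial j Hw.
have Lvw j := L4_mul mO (L4v j) L4w.
pose A j := sqn (fun x => v x j ord0 * w x).
pose B j := sqn (wpartial j w).
(* [c j * e] will bound [|v_j z|^2] for [z = w - phi], the 32 coming from the [L^4] approximation.
   [K j] adds the bounds of three error terms, times 3 for the square of a sum of three. *)
pose c j := Num.sqrt (sqn4 (fun x => v x j ord0)) * 32.
pose K j := 3 * (A j + B j * c j + c j).
apply: (@eq0_of_sqr_le _ _ ((\sum_j Num.sqrt (K j)) ^+ 2)) => e e0 e1.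
have [phi [tphi dphi L4z z4]] := H10_L4_approx d23 mO finO Hw e0.
have Cphi := test_function_C1c_in tphi; have [Lphi Ldphi] := C1c_in_L2 mO finO Cphi.
have L4phi := C1c_in_L4 mO finO Cphi.
pose z x := w x - phi x; pose g j x := wpartial j w x - partial j phi x.
have Lg j : L2 (g j) by exact: L2B.
have ge j : sqn (g j) <= e.
  rewrite H1_dist2E in dphi; apply: le_trans (ltW dphi).
  exact: (@sqn_partial_le_h1n _ _ _ _ g j).
have Lvz j : L2 (fun x => v x j ord0 * z x) by exact: (L4_mul mO (L4v j) L4z).
have c0 j : 0 <= c j by apply: mulr_ge0; [exact: sqrtr_ge0|exact: ler0n].
have vz j : sqn (fun x => v x j ord0 * z x) <= c j * e.
  have v40 : 0 <= sqn4 (fun x => v x j ord0) by exact: ip_ge0.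
  rewrite -ler_sqr ?nnegrE ?ip_ge0 ?mulr_ge0//; last exact: ltW.
  apply: le_trans (L4_mul_ip_le mO (L4v j) L4z) _.
  by rewrite /c -mulrA exprMn sqr_sqrtr//; exact: ler_wpM2l v40 _ _ z4.
have Lphid j : L2 (fun x => phi x * partial j phi x).
  have [K' phiK] := C1c_bounded Cphi.1; have [[cphi _ cdphi _] _] := Cphi.
  apply: (@L2_bounded _ _ _ mO finO _ (K' * K')).
    by apply: measurable_funM; apply: measurable_funS (continuous_measurable_rV _).
  by move=> x; have [h1 h2] := phiK x; rewrite normrM; apply: ler_pM.
pose D j := ip (wpartial j w) (fun x => v x j ord0 * w x) -
            ip (fun x => v x j ord0) (fun x => phi x * partial j phi x).
(* With [g] and [z] the errors in the gradient and in [w], one has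
   [dw w - dphi phi = g w + dw z - g z]: each product has a small factor. *)
have DE j : D j = ip (g j) (fun x => v x j ord0 * w x) +
    ip (wpartial j w) (fun x => v x j ord0 * z x) -
    ip (g j) (fun x => v x j ord0 * z x).
  have Lv := H10_L2 (Hv j).
  have i1 := L2_mul_integrable mO (Lg j) (Lvw j).
  have i2 := L2_mul_integrable mO (Ldw j) (Lvz j).
  have i3 := L2_mul_integrable mO (Lg j) (Lvz j).
  have i4 := L2_mul_integrable mO (Ldw j) (Lvw j).
  have i5 := L2_mul_integrable mO Lv (Lphid j).
  rewrite /D /Defs.ip -RintegralB// -RintegralD//.
  rewrite -(RintegralB mO (f1 := fun x => g j x * (v x j ord0 * w x) +
    wpartial j w x * (v x j ord0 * z x)))//; last first.
    by rewrite (_ : _ \o _ = (fun x => (g j x * (v x j ord0 * w x))%:E) \+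
      (fun x => (wpartial j w x * (v x j ord0 * z x))%:E))%E//; exact: integrableD.
  by apply: eq_Rintegral => x _; rewrite /g /z; ring.
have DK j : `|D j| <= Num.sqrt (K j) * Num.sqrt e.
  have A0 : 0 <= A j by exact: ip_ge0.
  have B0 : 0 <= B j by exact: ip_ge0.
  have K0 : 0 <= K j by rewrite /K mulr_ge0// !addr_ge0// mulr_ge0.
  rewrite -sqrtrM// -sqrtr_sqr ler_wsqrtr// DE.
  set t1 := ip (g j) (fun x => v x j ord0 * w x).
  set t2 := ip (wpartial j w) _; set t3 := ip (g j) (fun x => v x j ord0 * z x).
  have h1 : t1 ^+ 2 <= A j * e.
    apply: le_trans (cauchy_schwarz_ip mO (Lg j) (Lvw j)) _.
    by rewrite mulrC; apply: ler_wpM2l; [exact: A0|exact: ge].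
  have h2 : t2 ^+ 2 <= B j * c j * e.
    apply: le_trans (cauchy_schwarz_ip mO (Ldw j) (Lvz j)) _.
    by rewrite -mulrA; apply: ler_wpM2l; [exact: B0|exact: vz].
  have h3 : t3 ^+ 2 <= c j * e.
    apply: le_trans (cauchy_schwarz_ip mO (Lg j) (Lvz j)) _.
    (* Both factors are of order [e]; one of them is bounded by 1 through [e <= 1]. *)
    rewrite -[leRHS]mul1r; apply: ler_pM; [exact: ip_ge0|exact: ip_ge0| |exact: vz].
    exact: le_trans (ge j) e1.
  have : (t1 + t2 - t3) ^+ 2 <= 3 * (t1 ^+ 2 + t2 ^+ 2 + t3 ^+ 2).
    clear; have := sqr_ge0 (t1 - t2); have := sqr_ge0 (t1 + t3).
    by have := sqr_ge0 (t2 + t3); nra.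
  move=> /le_trans; apply; rewrite /K; move: h1 h2 h3; clear; lra.
have -> : \sum_j ip (wpartial j w) (fun x => v x j ord0 * w x) = \sum_j D j.
  by rewrite /D sumrB test_convection_eq0// subr0.
rewrite -[e in leRHS]sqr_sqrtr; last exact: ltW.
rewrite -exprMn -[leLHS]real_normK ?num_real// ler_sqr ?nnegrE//; last first.
  by rewrite mulr_ge0 ?sqrtr_ge0// sumr_ge0// => j _; exact: sqrtr_ge0.
apply: le_trans (ler_norm_sum _ _ _) _.
by rewrite mulr_suml; apply: ler_sum => j _; exact: DK.
Qed.

Lemma convection_ipM_eq0 v (w : 'rV[R]_d -> 'cV[R]_d) :
  H10v v -> sqn (wdiv v) = 0 -> H10v w ->
  ipM Omega (fun x => wgrad Omega w x *m v x) w = 0.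
Proof.
move=> Hv divv Hw; rewrite /ipM /frob.
pose F i j x := wpartial j (fun y => w y i ord0) x * (v x j ord0 * w x i ord0).
have iF i j : mu.-integrable Omega (EFin \o F i j).
  apply: L2_mul_integrable => //; first exact/H10_wpartial/Hw.
  exact: (L4_mul mO (H10_L4 d23 mO finO (Hv j)) (H10_L4 d23 mO finO (Hw i))).
rewrite (_ : \int[_]_(x in _) _ = \int[mu]_(x in Omega) (\sum_i \sum_j F i j x)).
  rewrite Rintegral_sum2// big1// => i _.
  exact: (convection_eq0 Hv divv (Hw i)).
apply: eq_Rintegral => x _; apply: eq_bigr => i _.
rewrite big_ord_recl big_ord0 addr0 mxE mulr_suml; apply: eq_bigr => j _.
by rewrite mxE /F mulrA.
Qed.

End convection.

(** * The energy estimate *)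

(** Induction, multiplying the previous bound by [1 + c] and moving [c tau V] to the left at each
    step. The first step keeps [c U 0] as it is, so the sum of [V] starts at 1 and the power is [n]
    after [n + 1] steps. *)
Lemma discrete_gronwall (R : realType) (U V G : nat -> R) (tau c : R) (N : nat) :
  0 <= tau -> 0 <= c -> (forall n, 0 <= V n) -> (forall n, 0 <= G n) ->
  (forall n, (n < N)%N ->
    U n.+1 + tau * V n.+1 <= U n + tau * V n + c * U n + G n.+1) ->
  forall n, (n < N)%N ->
  U n.+1 + tau * V n.+1 + c * tau * \sum_(1 <= k < n.+1) V k <=
  (1 + c) ^+ n * ((1 + c) * U 0%N + tau * V 0%N + \sum_(1 <= k < n.+2) G k).
Proof.
move=> tau0 c0 V0 G0 step; elim=> [|n IH] nN.
  rewrite big_geq// mulr0 addr0 expr0 mul1r big_nat1.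
  by apply: le_trans (step 0%N nN) _; lra.
have := step n.+1 nN; have := IH (ltnW nN).
rewrite [in X in _ -> _ -> X](big_nat_recr n.+1)//=.
rewrite [in X in _ -> _ -> X](big_nat_recr n.+2)//=.
set S := \sum_(1 <= k < n.+1) V k; set SG := \sum_(1 <= k < n.+2) G k.
set P := (1 + c) ^+ n; set C := (1 + c) * U 0%N + _ => IHn stepn.
have S0 : 0 <= S by apply: sumr_ge0.
have P1 : 1 <= (1 + c) ^+ n.+1 by rewrite exprn_ege1// lerDl.
have : (1 + c) * (U n.+1 + tau * V n.+1 + c * tau * S) <= (1 + c) * (P * (C + SG)).
  by apply: ler_wpM2l IHn; rewrite addr_ge0.
rewrite mulrA -exprS => h.
have : G n.+2 <= (1 + c) ^+ n.+1 * G n.+2 by rewrite ler_peMl.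
(* The slack left because the accumulated sum [c tau S] is multiplied by [1 + c] as well. *)
have : 0 <= c * (c * tau * S) by rewrite !mulr_ge0.
by nra.
Qed.

(** The arithmetic of one time step: [s], [V] and [s'], [V'] are the squared [L^2] and viscous norms
    at the old and new level, [B] is the squared increment, [P] the increment tested with the new
    velocity, [E] the explicit viscous term, [X] and [Y] the forcing tested with the new and old
    velocity. [B] cancels, and one of two copies of [tau V'] is spent on [E]. *)
Lemma energy_combination (R : realFieldType) (s' s V' V B E X Y P F tau k c : R) :
  2 * P = s' - s + B -> P + tau * V' = tau * (- E + X) ->
  tau * (2 * (X - Y)) <= tau * F + B -> tau * (2 * Y) <= k * F + c * s ->
  tau * - (2 * E) <= tau * (V + V') ->
  s' + tau * V' <= s + tau * V + c * s + (tau + k) * F.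
Proof. by move=> *; lra. Qed.

Theorem theorem3p2 (R : realType) (d : nat) (d23 : d = 2%N \/ d = 3%N)
  (Omega : set 'rV[R]_d) (domOmega : bounded_lipschitz_domain Omega)
  (T : R) (T_gt0 : 0 < T)
  (nu : 'rV[R]_d -> R -> R) (numin : R) (numin_gt0 : 0 < numin)
  (nu_ge : forall x t, closure Omega x -> 0 <= t <= T -> numin <= nu x t)
  (f : 'rV[R]_d -> R -> 'cV[R]_d) (f_L2Q : L2Q Omega T f)
  (u0 : 'rV[R]_d -> 'cV[R]_d) (u0_H10 : H10v Omega u0)
  (u0_div : {ae lebesgue_rV R d, forall x, Omega x -> wdiv Omega u0 x = 0})
  (N : nat) (N_ge2 : (2 <= N)%N)
  (tau := T / N%:R)
  (nu_ := fun (n : nat) x => nu x (n%:R * tau))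
  (f_ := fun (n : nat) x => f x (n%:R * tau))
  (f_L2 : forall n, (1 <= n <= N)%N -> L2M Omega (f_ n))
  (u : nat -> 'rV[R]_d -> 'cV[R]_d) (p : nat -> 'rV[R]_d -> R)
  (u_init : u 0%N = u0)
  (u_H10 : forall n, (n < N)%N -> H10v Omega (u n.+1))
  (p_L20 : forall n, (n < N)%N -> L20 Omega (p n.+1))
  (gradu := fun n => wgrad Omega (u n))
  (nu_norm : forall n, (n <= N)%N ->
    L2M Omega (fun x => Num.sqrt (nu_ n x) *: gradu n x))
  (nu_implicit : forall n w, (n < N)%N -> H10v Omega w ->
    (lebesgue_rV R d).-integrable Omega
      (fun x => (frob (nu_ n.+1 x *: gradu n.+1 x) (wgrad Omega w x))%:E))
  (nu_explicit : forall n w, (n < N)%N -> H10v Omega w ->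
    (lebesgue_rV R d).-integrable Omega
      (fun x => (frob (Num.sqrt (nu_ n x) *: (gradu n x)^T)
                      (Num.sqrt (nu_ n.+1 x) *: wgrad Omega w x))%:E))
  (momentum : forall n w, (n < N)%N -> H10v Omega w ->
    tau^-1 * ipM Omega (fun x => u n.+1 x - u n x) w
    + ipM Omega (fun x => nu_ n.+1 x *: gradu n.+1 x) (wgrad Omega w)
    + ipM Omega (fun x => gradu n.+1 x *m u n x) w
    - ip Omega (p n.+1) (wdiv Omega w)
    = - ipM Omega (fun x => Num.sqrt (nu_ n x) *: (gradu n x)^T)
                  (fun x => Num.sqrt (nu_ n.+1 x) *: wgrad Omega w x)
      + ipM Omega (f_ n.+1) w)
  (continuity : forall n q, (n < N)%N -> L20 Omega q ->
    ip Omega q (wdiv Omega (u n.+1)) = 0)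
  (eps : R) (eps_gt0 : 0 < eps)
  (visc := fun n => normM Omega (fun x => Num.sqrt (nu_ n x) *: gradu n x))
  (C0 := (1 + eps * (tau / T)) * normM Omega (u 0%N) ^+ 2
         + tau * visc 0%N ^+ 2) :
  normM Omega (u N) ^+ 2 + tau * visc N ^+ 2
    + eps * (\sum_(1 <= n < N) tau ^+ 2 / T * visc n ^+ 2)
  <= expR eps *
     (C0 + (tau + T / eps) *
           \sum_(1 <= n < N.+1) tau * normM Omega (f_ n) ^+ 2).
Proof.
have [oO _ _ bO _] := domOmega.
have mO := open_measurable_rV oO.
have finO := bounded_rV_measure_lty mO bO.
have N_gt0 : 0 < N%:R :> R by rewrite ltr0n (leq_trans _ N_ge2).
have tau_gt0 : 0 < tau by rewrite divr_gt0.
(* [Num.sqrt] vanishes on negative numbers, so [(sqrt nu)^2 = nu] relies on the sign of [nu] at the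
   time levels up to [T]. *)
have nu_gt0 n x : (n <= N)%N -> Omega x -> 0 <= nu_ n x.
  move=> nN Ox; apply: le_trans (ltW numin_gt0) _; apply: nu_ge.
    exact: subset_closure.
  rewrite mulr_ge0 ?ler0n ?(ltW tau_gt0)//= /tau mulrA ler_pdivrMr// mulrC.
  by rewrite ler_pM2l// ler_nat.
have Hu n : (n <= N)%N -> H10v Omega (u n).
  by case: n => [_|n nN]; [rewrite u_init|exact: u_H10].
have Lu n : (n <= N)%N -> L2M Omega (u n).
  by move=> nN i j; rewrite ord1; exact: H10_L2 (Hu n nN i).
(* For [n = 0] this comes from the initial datum, afterwards from the continuity equation with [q]
   the divergence itself. *)
have divu n : (n <= N)%N -> ip Omega (wdiv Omega (u n)) (wdiv Omega (u n)) = 0.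
  case: n => [_|n nN].
    have Ldiv := L2_wdiv mO (Hu 0%N (leq0n N)).
    rewrite /ip /Rintegral (ae_eq_integral (cst 0%E))//.
    - by rewrite integral0.
    - exact: measurable_int (L2_mul_integrable mO Ldiv Ldiv).
    - rewrite u_init; apply: filterS u0_div => x h Ox.
      by rewrite (h Ox) mul0r.
  exact: continuity n (wdiv Omega (u n.+1)) nN (wdiv_L20 mO finO (Hu _ nN)).
pose sq n : R := ipM Omega (u n) (u n).
pose V n : R := visc n ^+ 2.
pose F n : R := normM Omega (f_ n) ^+ 2.
(* The relative growth per time step; [N c = eps]. *)
pose c := eps * (tau / T).
have c_ge0 : 0 <= c by rewrite mulr_ge0 ?divr_ge0// ltW.
have VE n : V n = ipM Omega (fun x => Num.sqrt (nu_ n x) *: gradu n x)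
                            (fun x => Num.sqrt (nu_ n x) *: gradu n x).
  exact: normM_sqr.
have step n : (n < N)%N ->
    sq n.+1 + tau * V n.+1 <= sq n + tau * V n + c * sq n +
      (tau + T / eps) * (tau * F n.+1).
  move=> nN; have nN' := ltnW nN.
  have := momentum n (u n.+1) nN (Hu _ nN).
  have conv0 : ipM Omega (fun x => gradu n.+1 x *m u n x) (u n.+1) = 0.
    have := @convection_ipM_eq0 R d Omega d23 mO finO _ _
      (Hu n nN') (divu n nN') (Hu n.+1 nN).
    exact.
  (* The new pressure is itself taken as [q] in the continuity equation. *)
  rewrite conv0 (continuity n (p n.+1) nN (p_L20 n nN)) addr0 subr0.
  have -> : ipM Omega (fun x => nu_ n.+1 x *: gradu n.+1 x)
      (wgrad Omega (u n.+1)) = V n.+1.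
    rewrite VE; apply: eq_Rintegral => x /[!inE] Ox.
    do 2 (apply: eq_bigr => ? _); rewrite !mxE mulrACA -expr2 sqr_sqrtr ?mulrA//.
    exact: nu_gt0.
  pose B := ipM Omega (fun x => u n.+1 x - u n x) (fun x => u n.+1 x - u n x).
  have := ipMB_polar mO (Lu _ nN) (Lu _ nN').
  rewrite -/B -/(sq n) -/(sq n.+1) => polar.
  pose E := ipM Omega (fun x => Num.sqrt (nu_ n x) *: (gradu n x)^T)
                (fun x => Num.sqrt (nu_ n.+1 x) *: wgrad Omega (u n.+1) x).
  have LT : L2M Omega (fun x => Num.sqrt (nu_ n x) *: (gradu n x)^T).
    move=> i j; rewrite (_ : (fun _ => _) =
      (fun x => (Num.sqrt (nu_ n x) *: gradu n x) j i)); first exact: nu_norm.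
    by apply/funext => x; rewrite !mxE.
  (* Transposition preserves the Frobenius norm, so the explicit term is measured by [V n]. *)
  have VT : V n = ipM Omega (fun x => Num.sqrt (nu_ n x) *: (gradu n x)^T)
      (fun x => Num.sqrt (nu_ n x) *: (gradu n x)^T).
    rewrite VE; apply: eq_Rintegral => x _; rewrite /frob exchange_big/=.
    by do 2 (apply: eq_bigr => ? _); rewrite !mxE.
  have youngE : - (2 * E) <= V n + V n.+1.
    by rewrite VT VE; apply: ipM_youngN => //; exact: nu_norm.
  have Lf : L2M Omega (f_ n.+1) by exact: f_L2.
  have LB := L2MB mO (Lu _ nN) (Lu _ nN').
  have FE : F n.+1 = ipM Omega (f_ n.+1) (f_ n.+1) by exact: normM_sqr.
  pose P := ipM Omega (fun x => u n.+1 x - u n x) (u n.+1).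
  pose X := ipM Omega (f_ n.+1) (u n.+1); pose Y := ipM Omega (f_ n.+1) (u n).
  (* Young's inequality with weight [tau]: after multiplication by [tau] the increment contributes
     exactly [B], which the polarisation identity supplies. *)
  have f1 : 2 * (X - Y) <= tau * F n.+1 + tau^-1 * B.
    rewrite /X /Y FE -(ipMBr mO (Lu _ nN) (Lu _ nN') Lf).
    exact: (ipM_young mO tau_gt0 Lf LB).
  (* The weight [T / eps] is chosen so that [tau (T / eps)^-1 = c]. *)
  have f2 : 2 * Y <= T / eps * F n.+1 + (T / eps)^-1 * sq n.
    by rewrite FE; exact: (ipM_young mO (divr_gt0 T_gt0 eps_gt0) Lf (Lu _ nN')).
  rewrite -/E -/P -/X => mom; rewrite -/P in polar.
  have momt : P + tau * V n.+1 = tau * (- E + X).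
    by rewrite -mom mulrDr mulVKf ?gt_eqF.
  have f1t : tau * (2 * (X - Y)) <= tau * (tau * F n.+1) + B.
    apply: le_trans (ler_wpM2l (ltW tau_gt0) f1) _.
    by rewrite mulrDr mulVKf ?gt_eqF.
  have f2t : tau * (2 * Y) <= T / eps * (tau * F n.+1) + c * sq n.
    apply: le_trans (ler_wpM2l (ltW tau_gt0) f2) _.
    rewrite mulrDr mulrCA lerD2l le_eqVlt; apply/orP; left; apply/eqP.
    by rewrite /c invf_div; ring.
  have Et : tau * - (2 * E) <= tau * (V n + V n.+1) by rewrite ler_pM2l.
  exact: energy_combination polar momt f1t f2t Et.
have V_ge0 n : 0 <= V n by exact: sqr_ge0.
have G_ge0 n : 0 <= (tau + T / eps) * (tau * F n).
  apply: mulr_ge0; first by rewrite addr_ge0 ?divr_ge0 ?ltW.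
  by apply: mulr_ge0; [exact: ltW|exact: sqr_ge0].
have Npred : N = N.-1.+1 by rewrite prednK// (leq_trans _ N_ge2).
(* At index [N - 1] the viscous sum ends at [N - 1] and the forcing sum at [N]. *)
have := @discrete_gronwall R sq V (fun n => (tau + T / eps) * (tau * F n))
  tau c N (ltW tau_gt0) c_ge0 V_ge0 G_ge0 step N.-1.
rewrite -Npred leqnn => /(_ isT) main.
have -> : normM Omega (u N) ^+ 2 = sq N by exact: normM_sqr.
have -> : C0 = (1 + c) * sq 0%N + tau * V 0%N by rewrite /C0 normM_sqr.
have -> : eps * (\sum_(1 <= n < N) tau ^+ 2 / T * visc n ^+ 2) =
    c * tau * \sum_(1 <= k < N) V k.
  by rewrite -mulr_sumr mulrA /c; congr (_ * _); ring.
rewrite mulr_sumr; apply: le_trans main _.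
apply: ler_wpM2r.
  apply: addr_ge0; last by apply: sumr_ge0 => k _; exact: G_ge0.
  apply: addr_ge0; apply: mulr_ge0; [|exact: ipM_ge0|exact: ltW|exact: V_ge0].
  by rewrite addr_ge0.
(* [(1 + c)^(N-1) <= (1 + c)^N <= exp(c)^N], and [c N = eps] because [tau N = T]. *)
apply: (@le_trans _ _ (expR c ^+ N)).
  apply: (@le_trans _ _ ((1 + c) ^+ N)).
    by rewrite [in leRHS]Npred exprS ler_peMl ?exprn_ge0 ?addr_ge0// lerDl.
  by rewrite lerXn2r ?nnegrE ?addr_ge0 ?expR_ge0// expR_ge1Dx.
rewrite -expRM_natl ler_expR /c /tau.
by rewrite le_eqVlt; apply/orP; left; apply/eqP; field; rewrite !gt_eqF.
Qed.
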